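(* Let $K$ be a field, $Q$ a finite quiver, $I$ an admissible ideal of $KQ$ and $A=KQ/I$. Let $M=M(w)$ be a string module over $A$, where the string $w$ has $n$ vertices, let $\mathcal G=\mathcal G(w)$ be the corresponding snake graph (which has $n$ tiles), and let $\sigma_M\in\mathfrak S_{n+1}$ be the associated Coxeter element of $M$. Then there are lattice bijections (isomorphisms of lattices) between (1) the lattice given by the interval $[e,\sigma_M]$ in the weak Bruhat order of $\mathfrak S_{n+1}$, where $e$ is the identity; (2) the canonical submodule lattice $\mathcal L(M)$; (3) the lattice $\mathcal L(\mathcal G)$ of perfect matchings of $\mathcal G$.
   Context: **Strings and string modules.** For an arrow $a$ of $Q$, $s(a)$ is its start and $t(a)$ its end; its formal inverse $a^{-1}$ satisfies $s(a^{-1})=t(a)$, $t(a^{-1})=s(a)$. A string is a word $w=a_1\cdots a_{n-1}$ in which each $a_i$ is an arrow or the inverse of an arrow, $s(a_{i+1})=t(a_i)$, $a_{i+1}\neq a_i^{-1}$ for all $i$, and no subword of $w$ or of its inverse lies in $I$; trivial strings (single vertices, $n=1$) are allowed. Its vertices are $v_1,\dots,v_n$, so $w=v_1a_1v_2\cdots a_{n-1}v_n$ (a vertex of $Q$ may occur several times). The string module $M(w)$ over $A$ has basis $e_1,\dots,e_n$, with $e_i$ placed at vertex $v_i$; if $a_i$ is an arrow it sends $e_i\mapsto e_{i+1}$; if $a_i$ is the inverse of an arrow $b$, then $b$ sends $e_{i+1}\mapsto e_i$; all other actions of arrows on basis vectors are zero. **Canonical submodule lattice.** A canonically embedded submodule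 $(N,\varphi)$ of $M=M(w)$ is a submodule spanned by a subset of $\{e_1,\dots,e_n\}$, where the embedding $\varphi:N\to M$ is induced by the identity on the non-zero components ($0$ and $M$ included). The canonical submodule lattice $\mathcal L(M)$ is the set of canonically embedded submodules with $(N,\varphi)\le(N',\varphi')$ iff $\varphi'|_N=\varphi$ (that is, inclusion of the images in $M$). Each edge $(N,\varphi)<(N',\varphi')$ of its Hasse diagram adds exactly one basis vector $e_i$; the edge is labelled by the position $i\in\{1,\dots,n\}$. **Snake graphs.** A tile is a unit square in the plane with sides parallel to the axes, viewed as a graph with 4 vertices and 4 edges. A snake graph is obtained from tiles $T_1,\dots,T_n$ by gluing, for each $i$, $T_{i+1}$ to $T_i$ along the right or the top edge of $T_i$. Three consecutive tiles form a straight piece if both gluings are to the right or both on top, and a zigzag otherwise. The snake graph $\mathcal G(w)$ of $w=a_1\cdots a_{n-1}$ has $n$ tiles $T_1,\dots,T_n$, with $T_i$ corresponding to $v_i$; $T_2$ is to the right of $T_1$ if $a_1$ is an arrow (direct) and on top of $T_1$ if $a_1$ is an inverse arrow; and for $2\le i\le n-1$ the tiles $T_{i-1},T_i,T_{i+1}$ form a zigzag if $a_{i-1},a_i$ are both direct or both inverse, and a straight piece otherwise. **Perfect matchings.** A perfect matching of a graph is a set of edges such that every vertex is incident to exactly one of them. A boundary edge of $\mathcal G$ is an edge belonging to only one tile. The minimal perfect matching $P_{min}$ of $\mathcal G(w)$ is the perfect matching consisting of boundary edges only, such that whenever $v_i$ is a sink of $w$ (all letters of $w$ adjacent to $v_i$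 point towards $v_i$, endpoints of $w$ included) the tile $T_i$ has two boundary edges in $P_{min}$. (If there is only one tile, $P_{min}$ is a fixed choice of one of the two perfect matchings.) For a perfect matching $P$, the symmetric difference $P\ominus P_{min}=(P\cup P_{min})\setminus(P\cap P_{min})$ encloses a set of tiles of $\mathcal G$. The lattice $\mathcal L(\mathcal G)$ is the set of perfect matchings of $\mathcal G$ with minimum $P_{min}$, in which $P'$ covers $P$ iff $P'$ is obtained from $P$ by rotating one tile $T$ (replacing two opposite edges of $T$ lying in $P$ by the other two edges of $T$) and the tiles enclosed by $P'\ominus P_{min}$ are those enclosed by $P\ominus P_{min}$ together with $T$. **Associated Coxeter element.** $\mathfrak S_{n+1}$ is the symmetric group on $n+1$ letters with simple reflections $s_i=(i\ \ i+1)$, $1\le i\le n$. Take a maximal chain of $\mathcal L(M)$ from $0$ to $M$, with edge labels $i_1,\dots,i_n$ read from bottom to top. Then $\sigma_M=s_{i_1}\cdots s_{i_n}$; this element does not depend on the chosen maximal chain. The weak Bruhat order is taken to be the right weak order: $u\le v$ iff $\ell(v)=\ell(u)+\ell(u^{-1}v)$, where $\ell$ is the Coxeter length. *)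

(* Defs.v *)
From HB Require Import structures.
From Stdlib Require Import Relation_Operators.
From mathcomp Require Import all_boot all_order all_algebra all_fingroup.
From mathcomp Require Import finmap monalg.
From mathcomp Require Import boolp classical_sets functions.

Set Implicit Arguments.
Unset Strict Implicit.
Unset Printing Implicit Defensive.

Import Order.TTheory GRing.Theory Num.Theory.

Local Open Scope classical_set_scope.
Local Open Scope ring_scope.

(* A lattice is given by a set [A] of elements of some type together with a
   relation [le], of which only the restriction to [A] matters. *)
Section Lattices.
Context {T : Type}.
Implicit Types (A : set T) (le : T -> T -> Prop) (x y z : T).

Definition is_meet A le x y z : Prop :=
  [/\ A z, le z x, le z y & forall t, A t -> le t x -> le t y -> le t z].

Definition is_join A le x y z : Prop :=
  [/\ A z, le x z, le y z & forall t, A t -> le x t -> le y t -> le z t].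

Record is_lattice A le : Prop := IsLattice {
  lattice_refl : forall x, A x -> le x x;
  lattice_anti : forall x y, A x -> A y -> le x y -> le y x -> x = y;
  lattice_trans : forall x y z, A x -> A y -> A z -> le x y -> le y z -> le x z;
  lattice_meet : forall x y, A x -> A y -> exists z, is_meet A le x y z;
  lattice_join : forall x y, A x -> A y -> exists z, is_join A le x y z
}.
End Lattices.

Record lattice_iso {T U : Type} (A : set T) (leA : T -> T -> Prop)
    (B : set U) (leB : U -> U -> Prop) (f : T -> U) : Prop := LatticeIso {
  lattice_iso_bij : set_bij A B f;
  lattice_iso_meet : forall x y z, A x -> A y ->
    is_meet A leA x y z -> is_meet B leB (f x) (f y) (f z);
  lattice_iso_join : forall x y z, A x -> A y ->
    is_join A leA x y z -> is_join B leB (f x) (f y) (f z)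
}.

Record quiver := Quiver {
  vertex : finType;
  arrow : finType;
  source : arrow -> vertex;
  target : arrow -> vertex
}.

(* [walk s t x l]: the steps [l], where step [a] goes from [s a] to [t a],
   compose from left to right to a walk starting at [x]. *)
Fixpoint walk (V : eqType) (S : Type) (s t : S -> V) (x : V) (l : seq S) :
    bool :=
  if l is a :: l' then (s a == x) && walk s t (t a) l' else true.

Definition walk_end (V S : Type) (t : S -> V) (x : V) (l : seq S) : V :=
  last x (map t l).

Lemma walk_cat (V : eqType) (S : Type) (s t : S -> V) x l1 l2 :
  walk s t x (l1 ++ l2) = walk s t x l1 && walk s t (walk_end t x l1) l2.
Proof. by elim: l1 x => //= a l1 IH x; rewrite IH andbA. Qed.

Lemma walk_end_cat (V S : Type) (t : S -> V) x l1 l2 :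
  walk_end t x (l1 ++ l2) = walk_end t (walk_end t x l1) l2.
Proof. by rewrite /walk_end map_cat last_cat. Qed.

Section Paths.
Variable Q : quiver.

Definition is_qpath (p : vertex Q * seq (arrow Q)) : bool :=
  walk (@source Q) (@target Q) p.1 p.2.

(* The pair [(x, [::])] is the trivial path at [x]. *)
Record qpath := QPath { qpath_val :> vertex Q * seq (arrow Q);
                        qpathP : is_qpath qpath_val }.
HB.instance Definition _ := [isSub for qpath_val].
HB.instance Definition _ := [Choice of qpath by <:].

Definition qpath_start (p : qpath) : vertex Q := (val p).1.
Definition qpath_arrows (p : qpath) : seq (arrow Q) := (val p).2.
Definition qpath_end (p : qpath) : vertex Q :=
  walk_end (@target Q) (qpath_start p) (qpath_arrows p).
Definition qpath_length (p : qpath) : nat := size (qpath_arrows p).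

Definition trivial_qpath (x : vertex Q) : qpath := @QPath (x, [::]) isT.

Fact arrow_qpath_subproof (a : arrow Q) : is_qpath (source a, [:: a]).
Proof. by rewrite /is_qpath /= eqxx. Qed.
Definition arrow_qpath (a : arrow Q) : qpath := QPath (arrow_qpath_subproof a).

(* Concatenation, first [p] then [q]; [None] if they do not compose. *)
Definition qpath_cat (p q : qpath) : option qpath :=
  if qpath_end p == qpath_start q
  then insub (qpath_start p, qpath_arrows p ++ qpath_arrows q) else None.

Lemma qpath_catP p q : qpath_end p = qpath_start q ->
  exists2 r, qpath_cat p q = Some r &
    val r = (qpath_start p, qpath_arrows p ++ qpath_arrows q).
Proof.
move=> pq; rewrite /qpath_cat pq eqxx.
case: insubP => [r _ vr|]; first by exists r.
case: p q pq => [[x s] sP] [[y t] tP].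
rewrite /is_qpath /qpath_end /qpath_start /qpath_arrows /= in sP tP * => e.
by rewrite /is_qpath /= walk_cat e sP tP.
Qed.

Lemma qpath_catN p q : qpath_end p <> qpath_start q -> qpath_cat p q = None.
Proof. by move=> /eqP/negbTE pq; rewrite /qpath_cat pq. Qed.

Lemma qpath_catA p q r :
  obind (fun u => qpath_cat u r) (qpath_cat p q) =
  obind (qpath_cat p) (qpath_cat q r).
Proof.
have [pq|pq] := eqVneq (qpath_end p) (qpath_start q); last first.
  rewrite (qpath_catN (elimN eqP pq)) /=.
  have [qr|qr] := eqVneq (qpath_end q) (qpath_start r); last first.
    by rewrite (qpath_catN (elimN eqP qr)).
  have [v -> vE] := qpath_catP qr; rewrite /= qpath_catN //.
  by rewrite {1}/qpath_start vE; apply/eqP.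
have [u -> uE] := qpath_catP pq.
have ue : qpath_end u = qpath_end q.
  by rewrite /qpath_end /qpath_start /qpath_arrows uE /= walk_end_cat
    -/(qpath_end p) pq.
have [qr|qr] := eqVneq (qpath_end q) (qpath_start r); last first.
  rewrite (qpath_catN (elimN eqP qr)) /= qpath_catN //.
  by rewrite ue; apply/eqP.
have [v -> vE] := qpath_catP qr; rewrite /=.
have ur : qpath_end u = qpath_start r by rewrite ue.
have pv : qpath_end p = qpath_start v by rewrite pq /qpath_start vE.
have [w1 -> w1E] := qpath_catP ur; have [w2 -> w2E] := qpath_catP pv.
congr Some; apply: val_inj.
by rewrite w1E w2E /qpath_start /qpath_arrows uE vE /= catA.
Qed.

Lemma insub_qpath (p : qpath) :
  insub (qpath_start p, qpath_arrows p) = Some p.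
Proof. by rewrite -[RHS]valK /qpath_start /qpath_arrows -surjective_pairing. Qed.

Lemma trivial_qpath_cat x p :
  qpath_cat (trivial_qpath x) p = if x == qpath_start p then Some p else None.
Proof.
have -> : qpath_cat (trivial_qpath x) p =
  if x == qpath_start p then insub (x, qpath_arrows p) else None by [].
by case: eqP => // ->; rewrite insub_qpath.
Qed.

Lemma qpath_cat_trivial x p :
  qpath_cat p (trivial_qpath x) = if qpath_end p == x then Some p else None.
Proof.
have -> : qpath_cat p (trivial_qpath x) = if qpath_end p == x
  then insub (qpath_start p, qpath_arrows p ++ [::]) else None by [].
by rewrite cats0 insub_qpath.
Qed.
End Paths.

Section PathAlgebra.
Variables (K : fieldType) (Q : quiver).

(* The path algebra KQ: finitely supported functions on paths, [<< p >>] being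
   the basis element given by the path [p]. *)
Definition path_algebra : Type := {malg K[qpath Q]}.
Local Notation KQ := path_algebra.
HB.instance Definition _ := GRing.Lmodule.on KQ.

Implicit Types (f g h : KQ).

Definition opath (c : K) (o : option (qpath Q)) : KQ :=
  if o is Some r then << c *g r >> else 0.

Lemma opath0 o : opath 0 o = 0.
Proof. by case: o => //= r; rewrite monalgU0. Qed.
Lemma opathD c d o : opath (c + d) o = opath c o + opath d o.
Proof. by case: o => [r|] /=; rewrite ?monalgUD // addr0. Qed.

Definition path_one : KQ := \sum_x << trivial_qpath x >>.

Definition path_mul f g : KQ :=
  \sum_(p <- msupp f) \sum_(q <- msupp g)
    opath (f@_p * g@_q) (qpath_cat p q).

Lemma path_mulw (d1 d2 : {fset qpath Q}) f g :
  (msupp f `<=` d1)%fset -> (msupp g `<=` d2)%fset ->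
  path_mul f g =
  \sum_(p <- d1) \sum_(q <- d2) opath (f@_p * g@_q) (qpath_cat p q).
Proof.
move=> le1 le2; rewrite /path_mul (big_fset_incl _ le1) /=.
  apply/eq_bigr=> p _; apply/big_fset_incl => // q _ /mcoeff_outdom ->.
  by rewrite mulr0 opath0.
move=> p _ /mcoeff_outdom fp.
by rewrite big1 => // q _; rewrite fp mul0r opath0.
Qed.

Lemma path_mul0l : left_zero 0 path_mul.
Proof. by move=> g; rewrite /path_mul msupp0 big_seq_fset0. Qed.

Lemma path_mul0r : right_zero 0 path_mul.
Proof.
by move=> f; rewrite /path_mul big1 // => p _; rewrite msupp0 big_seq_fset0.
Qed.

Lemma path_mulDl : left_distributive path_mul +%R.
Proof.
move=> f g h.
rewrite (path_mulw (msuppD_le _ _) (fsubset_refl _)).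
rewrite (path_mulw (fsubsetUl (msupp f) (msupp g)) (fsubset_refl (msupp h))).
rewrite (path_mulw (fsubsetUr (msupp f) (msupp g)) (fsubset_refl (msupp h))).
rewrite -big_split /=; apply/eq_bigr=> p _.
rewrite -big_split /=; apply/eq_bigr=> q _.
by rewrite mcoeffD mulrDl opathD.
Qed.

Lemma path_mulDr : right_distributive path_mul +%R.
Proof.
move=> h f g.
rewrite (path_mulw (fsubset_refl _) (msuppD_le _ _)).
rewrite (path_mulw (fsubset_refl (msupp h)) (fsubsetUl (msupp f) (msupp g))).
rewrite (path_mulw (fsubset_refl (msupp h)) (fsubsetUr (msupp f) (msupp g))).
rewrite -big_split /=; apply/eq_bigr=> p _.
rewrite -big_split /=; apply/eq_bigr=> q _.
by rewrite mcoeffD mulrDr opathD.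
Qed.

Lemma path_mulUU c d p q :
  path_mul << c *g p >> << d *g q >> = opath (c * d) (qpath_cat p q).
Proof. by rewrite (path_mulw msuppU_le msuppU_le) !big_seq_fset1 !mcoeffUU. Qed.

Lemma path_mul_suml (J : Type) (s : seq J) (F : J -> KQ) g :
  path_mul (\sum_(i <- s) F i) g = \sum_(i <- s) path_mul (F i) g.
Proof. exact: (big_morph (path_mul^~ g) (fun _ _ => path_mulDl _ _ _)
  (path_mul0l g)). Qed.

Lemma path_mul_sumr (J : Type) (s : seq J) (F : J -> KQ) f :
  path_mul f (\sum_(i <- s) F i) = \sum_(i <- s) path_mul f (F i).
Proof. exact: (big_morph (path_mul f) (fun _ _ => path_mulDr _ _ _)
  (path_mul0r f)). Qed.

Lemma path_algebra_ext (phi psi : KQ -> KQ) :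
  {morph phi : f g / f + g} -> {morph psi : f g / f + g} ->
  (forall c p, phi << c *g p >> = psi << c *g p >>) -> phi =1 psi.
Proof.
move=> phiD psiD E f.
have phi0 : phi 0 = 0 by apply: (addrI (phi 0)); rewrite -phiD !addr0.
have psi0 : psi 0 = 0 by apply: (addrI (psi 0)); rewrite -psiD !addr0.
rewrite (monalgE f) (big_morph phi phiD phi0) (big_morph psi psiD psi0).
exact: eq_bigr.
Qed.

Lemma path_mulA : associative path_mul.
Proof.
move=> f g h; move: f; apply: path_algebra_ext => [f f'|f f'|c p].
- exact: path_mulDl.
- by rewrite !path_mulDl.
move: g; apply: path_algebra_ext => [g g'|g g'|d q].
- by rewrite path_mulDl path_mulDr.
- by rewrite path_mulDr path_mulDl.
move: h; apply: path_algebra_ext => [h h'|h h'|b r].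
- by rewrite !path_mulDr.
- exact: path_mulDr.
rewrite !path_mulUU; have := qpath_catA p q r.
case: (qpath_cat p q) (qpath_cat q r) => [u|] [v|] /= E.
- by rewrite !path_mulUU E mulrA.
- by rewrite path_mulUU E path_mul0r.
- by rewrite path_mulUU -E path_mul0l.
- by rewrite path_mul0l path_mul0r.
Qed.

Lemma path_mul1l : left_id path_one path_mul.
Proof.
move=> g; rewrite [RHS]monalgE [in LHS](monalgE g) path_mul_sumr.
apply: eq_bigr => p _; rewrite /path_one path_mul_suml.
rewrite (bigD1 (qpath_start p)) //= path_mulUU trivial_qpath_cat eqxx mul1r.
rewrite big1 ?addr0 // => x /negbTE xp.
by rewrite path_mulUU trivial_qpath_cat xp.
Qed.

Lemma path_mul1r : right_id path_one path_mul.
Proof.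
move=> g; rewrite [RHS]monalgE [in LHS](monalgE g) path_mul_suml.
apply: eq_bigr => p _; rewrite /path_one path_mul_sumr.
rewrite (bigD1 (qpath_end p)) //= path_mulUU qpath_cat_trivial eqxx mulr1.
rewrite big1 ?addr0 // => x /negbTE xp.
by rewrite path_mulUU qpath_cat_trivial eq_sym xp.
Qed.

HB.instance Definition _ := GRing.Zmodule_isPzRing.Build KQ
  path_mulA path_mul1l path_mul1r path_mulDl path_mulDr.

(* The [m]-th power of the arrow ideal: the span of the paths of length at
   least [m]. *)
Definition arrow_ideal_pow (m : nat) (f : KQ) : Prop :=
  forall p, p \in msupp f -> (m <= qpath_length p)%N.

Record admissible_ideal := AdmissibleIdeal {
  admissible_pred :> {pred path_algebra};
  admissible_zmod : zmod_closed admissible_pred;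
  admissible_mull : forall f g : path_algebra,
    g \in admissible_pred -> f * g \in admissible_pred;
  admissible_mulr : forall f g : path_algebra,
    f \in admissible_pred -> f * g \in admissible_pred;
  admissible_le : forall f : path_algebra,
    f \in admissible_pred -> arrow_ideal_pow 2 f;
  admissible_ge : exists2 m, (2 <= m)%N &
    forall f : path_algebra, arrow_ideal_pow m f -> f \in admissible_pred
}.
End PathAlgebra.

HB.instance Definition _ (K : fieldType) (Q : quiver)
    (I : admissible_ideal K Q) :=
  GRing.isZmodClosed.Build (path_algebra K Q) (admissible_pred I)
    (admissible_zmod I).

Section BoundQuiverAlgebra.
Variables (K : fieldType) (Q : quiver) (I : admissible_ideal K Q).
Local Open Scope quotient_scope.
Local Notation KQ := (path_algebra K Q).

Definition bound_algebra : Type :=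
  Quotient.quot (GRing.ZmodClosed.clone KQ (admissible_pred I) _).
Local Notation A := bound_algebra.
HB.instance Definition _ := GRing.Zmodule.on A.
HB.instance Definition _ := Quotient.on A.

Definition bound_class (f : KQ) : A := \pi_A f.

Definition bound_one : A := \pi_A 1.
Definition bound_mul (x y : A) : A :=
  \pi_A (generic_quotient.repr x * generic_quotient.repr y).

Lemma bound_classE (f g : KQ) :
  (f - g \in admissible_pred I) = (\pi_A f == \pi_A g :> A).
Proof. exact: Quotient.idealrBE. Qed.

Lemma bound_piM (f g : KQ) : bound_mul (\pi_A f) (\pi_A g) = \pi_A (f * g).
Proof.
apply/eqP; rewrite -bound_classE.
set f' := generic_quotient.repr _; set g' := generic_quotient.repr _.
have -> : f' * g' - f * g = f' * (g' - g) + (f' - f) * g.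
  by rewrite mulrBr mulrBl addrA subrK.
have [_ IB] := admissible_zmod I.
rewrite -[X in _ + X]opprK; apply: IB.
  by apply: admissible_mull; rewrite bound_classE reprK.
rewrite -mulNr; apply: admissible_mulr.
by rewrite opprB bound_classE reprK.
Qed.

Lemma bound_piD (f g : KQ) : \pi_A f + \pi_A g = \pi_A (f + g) :> A.
Proof. by rewrite [RHS]Quotient.pi_add. Qed.

Lemma bound_piP (x : A) : exists f : KQ, x = \pi_A f.
Proof. by exists (generic_quotient.repr x); rewrite reprK. Qed.

Fact bound_mulA : associative bound_mul.
Proof.
move=> x y z; have [f ->] := bound_piP x; have [g ->] := bound_piP y.
have [h ->] := bound_piP z.
by rewrite (bound_piM g h) (bound_piM f g) (bound_piM f) (bound_piM _ h) mulrA.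
Qed.
Fact bound_mul1l : left_id bound_one bound_mul.
Proof. by move=> x; have [f ->] := bound_piP x; rewrite bound_piM mul1r. Qed.
Fact bound_mul1r : right_id bound_one bound_mul.
Proof. by move=> x; have [f ->] := bound_piP x; rewrite bound_piM mulr1. Qed.
Fact bound_mulDl : left_distributive bound_mul +%R.
Proof.
move=> x y z; have [f ->] := bound_piP x; have [g ->] := bound_piP y.
have [h ->] := bound_piP z.
by rewrite bound_piD (bound_piM _ h) (bound_piM f h) (bound_piM g h)
  bound_piD mulrDl.
Qed.
Fact bound_mulDr : right_distributive bound_mul +%R.
Proof.
move=> x y z; have [f ->] := bound_piP x; have [g ->] := bound_piP y.
have [h ->] := bound_piP z.
by rewrite bound_piD (bound_piM f) (bound_piM f g) (bound_piM f h)
  bound_piD mulrDr.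
Qed.

HB.instance Definition _ := GRing.Zmodule_isPzRing.Build A
  bound_mulA bound_mul1l bound_mul1r bound_mulDl bound_mulDr.
End BoundQuiverAlgebra.

Section Strings.
Variable Q : quiver.

(* [(a, true)] is the arrow [a] and [(a, false)] its formal inverse. *)
Definition letter : Type := (arrow Q * bool)%type.

Definition direct (l : letter) : bool := l.2.
Definition letter_inv (l : letter) : letter := (l.1, ~~ l.2).
Definition letter_source (l : letter) : vertex Q :=
  if direct l then source l.1 else target l.1.
Definition letter_target (l : letter) : vertex Q :=
  if direct l then target l.1 else source l.1.

Definition word_inv (w : seq letter) : seq letter := rev (map letter_inv w).

Definition word_of_qpath (p : qpath Q) : seq letter :=
  [seq (a, true) | a <- qpath_arrows p].

(* The word [w] is given together with its first vertex [x], which makes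
   trivial strings available.  Positions are counted from [0]: the vertices are
   indexed by ['I_(size w).+1] and the letter number [i] joins the vertices
   number [i] and [i.+1].  Only the directed subwords of [w] and of its inverse
   are elements of KQ. *)
Record is_string (K : fieldType) (I : admissible_ideal K Q)
    (x : vertex Q) (w : seq letter) : Prop := IsString {
  string_walk : walk letter_source letter_target x w;
  string_reduced : sorted (fun a b => b != letter_inv a) w;
  string_nonzero : forall p : qpath Q, (0 < qpath_length p)%N ->
    infix (word_of_qpath p) w || infix (word_of_qpath p) (word_inv w) ->
    (<< p >> : path_algebra K Q) \notin I
}.

Definition word_vertex (x : vertex Q) (w : seq letter) (i : nat) : vertex Q :=
  nth x (x :: map letter_target w) i.

Definition is_sink (w : seq letter) (i : 'I_(size w).+1) : Prop :=
  (forall j l, j.+1 = i :> nat -> onth w j = Some l -> direct l) /\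
  (forall l, onth w i = Some l -> ~~ direct l).
End Strings.

Section StringModules.
Variables (K : fieldType) (Q : quiver) (I : admissible_ideal K Q).
Local Notation A := (bound_algebra I).

(* Paths are composed from left to right, so that the arrows of a direct
   subword of a string act on the module one after the other in the order of
   the word when modules are right modules, that is, left modules over the
   converse ring. *)
Definition right_act (M : lmodType A^c) (m : M) (f : path_algebra K Q) : M :=
  (bound_class I f : A^c) *: m.

Definition kscale (M : lmodType A^c) (k : K) (m : M) : M :=
  right_act m (k *: (1 : path_algebra K Q)).

(* [M] is the string module M(w), with its standard basis [e]. *)
Record is_string_module (x : vertex Q) (w : seq (letter Q))
    (M : lmodType A^c) (e : 'I_(size w).+1 -> M) : Prop := IsStringModule {
  string_module_basis : forall m : M,
    exists! c : {ffun 'I_(size w).+1 -> K}, m = \sum_i kscale (c i) (e i);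
  string_module_vertex : forall i,
    right_act (e i) << trivial_qpath (word_vertex x w i) >> = e i;
  string_module_direct : forall (i j : 'I_(size w).+1) b, j = i.+1 :> nat ->
    onth w i = Some (b, true) -> right_act (e i) << arrow_qpath b >> = e j;
  string_module_inverse : forall (i j : 'I_(size w).+1) b, j = i.+1 :> nat ->
    onth w i = Some (b, false) -> right_act (e j) << arrow_qpath b >> = e i;
  string_module_zero : forall (i : 'I_(size w).+1) b,
    onth w i <> Some (b, true) ->
    (forall k, i = k.+1 :> nat -> onth w k <> Some (b, false)) ->
    right_act (e i) << arrow_qpath b >> = 0
}.

Section CanonicalSubmodules.
Variables (M : lmodType A^c) (n : nat) (e : 'I_n -> M).

Definition is_submodule (N : set M) : Prop :=
  N 0 /\ forall (a : A^c) (m m' : M), N m -> N m' -> N (a *: m + m').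

Definition kspan (S : {set 'I_n}) : set M :=
  [set m | exists c : 'I_n -> K, m = \sum_(i in S) kscale (c i) (e i)].

(* The lattice L(M); its order is the inclusion of subsets of [M]. *)
Definition canonical_submodules : set (set M) :=
  [set N | is_submodule N /\ exists S : {set 'I_n}, N = kspan S].

Definition submodule_le (N N' : set M) : Prop := N `<=` N'.

Definition hasse_edge (N N' : set M) : Prop :=
  [/\ canonical_submodules N, canonical_submodules N',
      submodule_le N N' /\ N <> N' &
      forall L, canonical_submodules L -> submodule_le N L ->
        submodule_le L N' -> L = N \/ L = N'].

(* [N -- i1 -- N1 -- i2 -- N2 ...] is an ascending chain of labelled edges of
   the Hasse diagram which ends in [M]; the label of an edge is the position of
   the basis vector that it adds. *)
Fixpoint labelled_chain (N : set M) (s : seq ('I_n * set M)) : Prop :=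
  if s is (i, N') :: s' then
    [/\ hasse_edge N N', N' (e i), ~ N (e i) & labelled_chain N' s']
  else N = [set: M].

End CanonicalSubmodules.
End StringModules.

Section WeakOrder.
Variable n : nat.
Local Open Scope group_scope.

Definition simple_reflection (i : 'I_n) : 'S_n.+1 :=
  tperm (widen_ord (leqnSn n) i) (lift ord0 i).

(* In MathComp, [(u * v) x = v (u x)].  Nothing below depends on the convention
   for composing permutations: passing to the opposite one is an isomorphism
   [u |-> u^-1] of groups which fixes the simple reflections. *)
Definition reflection_word (s : seq 'I_n) : 'S_n.+1 :=
  \prod_(i <- s) simple_reflection i.

Definition has_word_of_size (u : 'S_n.+1) (k : nat) : bool :=
  [exists t : k.-tuple 'I_n, reflection_word t == u].

Lemma reflection_word_cat s t :
  reflection_word (s ++ t) = reflection_word s * reflection_word t.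
Proof. exact: big_cat. Qed.

Lemma has_wordP u : (exists s, reflection_word s = u) ->
  exists k, has_word_of_size u k.
Proof.
by case=> s <-; exists (size s); apply/existsP; exists (in_tuple s).
Qed.

Lemma tperm_word (x y : 'I_n.+1) : exists s, reflection_word s = tperm x y.
Proof.
wlog lexy : x y / (x <= y)%N.
  move=> H; case: (leqP x y) => [/H//|/ltnW/H[s sE]].
  by exists s; rewrite tpermC.
move: {-1}(y - x)%N (erefl (y - x)%N) => d; elim: d y lexy => [|d IH] y lexy dE.
  exists [::]; rewrite /reflection_word big_nil.
  suff -> : x = y by rewrite tperm1.
  by apply/val_inj/eqP; rewrite eqn_leq lexy /= -subn_eq0 dE.
have ltxy : (x < y)%N by rewrite -subn_gt0 dE.
have y_gt0 : (0 < y)%N by exact: leq_ltn_trans ltxy.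
have ltyn : (y.-1 < n)%N by rewrite -ltnS prednK.
pose z := widen_ord (leqnSn n) (Ordinal ltyn).
have zE : z = y.-1 :> nat by [].
have yE : y = lift ord0 (Ordinal ltyn).
  by apply: val_inj; rewrite /= /bump leq0n add1n prednK.
have lexz : (x <= z)%N by rewrite zE -ltnS prednK.
have [|s sE] := IH z lexz; first by rewrite zE -subn1 subnAC dE subn1.
have refl : reflection_word [:: Ordinal ltyn] = tperm z y.
  by rewrite /reflection_word big_seq1 /simple_reflection -yE.
have zy : z != y by rewrite -val_eqE /= neq_ltn ltn_predL y_gt0.
have xy : y != x by rewrite eq_sym -val_eqE neq_ltn ltxy.
have [xz|xz] := eqVneq x z.
  by exists [:: Ordinal ltyn]; rewrite refl xz.
exists ([:: Ordinal ltyn] ++ s ++ [:: Ordinal ltyn]).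
rewrite !reflection_word_cat refl sE -{1}(tpermV z y) -conjgE tpermJ.
by rewrite tpermL tpermD // eq_sym.
Qed.

Lemma word_ex (u : 'S_n.+1) : exists k, has_word_of_size u k.
Proof.
apply: has_wordP; have [ts -> _] := prod_tpermP u.
elim: ts => [|t ts [s sE]]; first by exists [::]; rewrite /reflection_word !big_nil.
have [r rE] := tperm_word t.1 t.2.
by exists (r ++ s); rewrite reflection_word_cat big_cons rE sE.
Qed.

Definition coxeter_length (u : 'S_n.+1) : nat := ex_minn (word_ex u).

Definition weak_le (u v : 'S_n.+1) : Prop :=
  coxeter_length v = (coxeter_length u + coxeter_length (u^-1 * v))%N.

Definition weak_interval (u v : 'S_n.+1) : set 'S_n.+1 :=
  [set x | weak_le u x /\ weak_le x v].
End WeakOrder.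

(* The product of the labels of a maximal chain of L(M), read from bottom to
   top; it does not depend on the chain. *)
Definition associated_coxeter (K : fieldType) (Q : quiver)
    (I : admissible_ideal K Q) (M : lmodType (bound_algebra I)^c) (n : nat)
    (e : 'I_n -> M) : 'S_n.+1 :=
  xget 1%g [set u | exists2 s, labelled_chain e [set 0] s &
                               u = reflection_word (map fst s)].

(* Unit squares of the plane with integral corners are represented by their
   bottom left corner.  A unit segment between integral points is represented
   by its bottom or left end point and by a boolean which is true when the
   segment is horizontal. *)
Definition grid_point : Type := (int * int)%type.
Definition square : Type := grid_point.
Definition segment : Type := (grid_point * bool)%type.

Definition incident (v : grid_point) (s : segment) : Prop :=
  v = s.1 \/ v = (if s.2 then (s.1.1 + 1, s.1.2) else (s.1.1, s.1.2 + 1)).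

Definition horizontal_sides (c : square) : set segment :=
  [set s | s = (c, true) \/ s = ((c.1, c.2 + 1), true)].
Definition vertical_sides (c : square) : set segment :=
  [set s | s = (c, false) \/ s = ((c.1 + 1, c.2), false)].
Definition sides (c : square) : set segment :=
  horizontal_sides c `|` vertical_sides c.

(* [enclosed D c]: the connected component containing the square [c] of the
   plane cut along the segments in [D] is bounded. *)
Definition adjacent_off (D : set segment) (c c' : square) : Prop :=
  exists s, [/\ sides c s, sides c' s & ~ D s].
Definition enclosed (D : set segment) (c : square) : Prop :=
  exists N : int, forall c', clos_refl_trans square (adjacent_off D) c c' ->
    `|c'.1| <= N /\ `|c'.2| <= N.

(* The gluings determined by a word, given by the list of booleans telling
   whether its letters are direct; a gluing is [true] for right, [false] for
   top.  Two consecutive gluings are different (zigzag) iff the corresponding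
   letters are both direct or both inverse. *)
Fixpoint gluings_after (glue dir : bool) (l : seq bool) : seq bool :=
  if l is dir' :: l' then
    let glue' := if dir' == dir then ~~ glue else glue in
    glue' :: gluings_after glue' dir' l'
  else [::].
Definition gluings (l : seq bool) : seq bool :=
  if l is dir :: l' then dir :: gluings_after dir dir l' else [::].

Section SnakeGraph.
Variables (Q : quiver) (w : seq (letter Q)).
Local Notation n := (size w).+1.

Definition tile (i : 'I_n) : square :=
  let l := take i (gluings (map (@direct Q) w)) in
  ((count id l)%:Z, (count negb l)%:Z).

Definition snake_edges : set segment := [set s | exists i, sides (tile i) s].
Definition snake_vertices : set grid_point :=
  [set v | exists2 s, snake_edges s & incident v s].

Definition perfect_matchings : set (set segment) :=
  [set P | P `<=` snake_edges /\
           forall v, snake_vertices v -> exists! s, P s /\ incident v s].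

Definition boundary_edge (s : segment) : Prop :=
  exists! i : 'I_n, sides (tile i) s.

(* With a single tile both perfect matchings satisfy this predicate. *)
Definition is_minimal_matching (P : set segment) : Prop :=
  [/\ perfect_matchings P,
      forall s, P s -> boundary_edge s &
      forall i : 'I_n, is_sink i -> exists s t, [/\ s <> t,
        sides (tile i) s /\ sides (tile i) t,
        boundary_edge s /\ boundary_edge t & P s /\ P t]].

Definition minimal_matching : set segment := xget set0 is_minimal_matching.

Definition enclosed_tiles (P : set segment) : set 'I_n :=
  [set i | enclosed (P `+` minimal_matching) (tile i)].

Definition rotation (i : 'I_n) (P P' : set segment) : Prop :=
  let h := horizontal_sides (tile i) in
  let v := vertical_sides (tile i) in
  (h `<=` P /\ P' = (P `\` h) `|` v) \/ (v `<=` P /\ P' = (P `\` v) `|` h).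

Definition matching_covers (P P' : set segment) : Prop :=
  [/\ perfect_matchings P, perfect_matchings P' &
      exists2 i, rotation i P P' &
                 enclosed_tiles P' = enclosed_tiles P `|` [set i]].

(* The order of L(G) is the one with the cover relation above. *)
Definition matching_le : set segment -> set segment -> Prop :=
  clos_refl_trans (set segment) matching_covers.
End SnakeGraph.

(* Main.v *)
(* A submodule spanned by basis vectors is a set S of positions closed under
   the arrows of the string, so L(M) is the lattice of these closed sets.

   The labels of a maximal chain form a word in which every simple reflection
   occurs once, and the letters that do not commute are neighbours, ordered by
   the direction of their arrow.  This order can be read off sigma, so the
   elements below sigma are the products of the subwords on the closed sets.

   The two matchings of the boundary of the snake graph take, on the tile
   number i, the horizontal or the vertical sides according to the parity of i,
   and P_min is the one with horizontal sides on the odd tiles.  The symmetric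
   difference of two perfect matchings has even degrees, so it is the boundary
   mod 2 of a unique set S of tiles, which is the set of tiles it encloses; the
   vertices of the shared edges turn "P_min + boundary of S is a perfect
   matching" into "S is closed". *)

From Stdlib Require Import Relation_Operators.
Require Import Defs.
From mathcomp Require Import all_boot all_order all_algebra all_fingroup.
From mathcomp Require Import zify finmap monalg.
From mathcomp Require Import boolp classical_sets functions.

Set Implicit Arguments.
Unset Strict Implicit.
Unset Printing Implicit Defensive.

Import Order.TTheory GRing.Theory Num.Theory.

(** * Order isomorphisms and closed sets *)

(** The three lattices are compared with the closed sets as ordered sets only: meets and joins are
    determined by the order, so an order isomorphism carries them along and they are computed on
    closed sets alone, as intersections and unions. The common tool is [closed_grow]: the arrows
    between positions form no cycle, so a closed set reaches any larger one by adding single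
    positions. This describes the edges of L(M), yields maximal chains and turns inclusions into
    sequences of rotations. For permutations everything rests on one fact: the letters of a word
    without repetitions occur in every word with the same product. Hence all reduced words of sigma
    are rearrangements of one another. P_min is picked by a choice operator, and a single tile
    leaves two candidates; the boolean [eps] records which one was picked. *)

Record order_iso {T U : Type} (A : set T) (leA : T -> T -> Prop)
    (B : set U) (leB : U -> U -> Prop) (f : T -> U) : Prop := OrderIso {
  order_iso_bij : set_bij A B f;
  order_iso_le : forall x y, A x -> A y -> leA x y <-> leB (f x) (f y)
}.

Section OrderIso.
Context {T U : Type} {A : set T} {leA : T -> T -> Prop}.
Context {B : set U} {leB : U -> U -> Prop} {f : T -> U}.
Hypothesis fP : order_iso A leA B leB f.

Lemma order_iso_fun x : A x -> B (f x).
Proof. by case: fP => -[fAB _ _] _; exact: fAB. Qed.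

Lemma order_iso_surj y : B y -> exists2 x, A x & f x = y.
Proof. by case: fP => -[_ _ fS] _; exact: fS. Qed.

Lemma order_iso_meet x y z : A x -> A y ->
  is_meet A leA x y z -> is_meet B leB (f x) (f y) (f z).
Proof.
have [_ le] := fP; move=> Ax Ay [Az zx zy zG]; split.
- exact: order_iso_fun.
- exact/le.
- exact/le.
- move=> _ /order_iso_surj[t At <-] /(le _ _ At Ax) tx /(le _ _ At Ay) ty.
  by apply/le => //; apply: zG.
Qed.

Lemma order_iso_join x y z : A x -> A y ->
  is_join A leA x y z -> is_join B leB (f x) (f y) (f z).
Proof.
have [_ le] := fP; move=> Ax Ay [Az zx zy zG]; split.
- exact: order_iso_fun.
- exact/le.
- exact/le.
- move=> _ /order_iso_surj[t At <-] /(le _ _ Ax At) tx /(le _ _ Ay At) ty.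
  by apply/le => //; apply: zG.
Qed.

Lemma order_iso_lattice : is_lattice A leA -> is_lattice B leB.
Proof.
have [_ le] := fP; move=> [refl anti trans meet join]; split.
- by move=> _ /order_iso_surj[x Ax <-]; apply/le => //; apply: refl.
- move=> _ _ /order_iso_surj[x Ax <-] /order_iso_surj[y Ay <-].
  by move=> /(le _ _ Ax Ay) xy /(le _ _ Ay Ax) yx; congr f; apply: anti.
- move=> _ _ _ /order_iso_surj[x Ax <-] /order_iso_surj[y Ay <-]
    /order_iso_surj[z Az <-] /(le _ _ Ax Ay) xy /(le _ _ Ay Az) yz.
  by apply/le => //; apply: trans xy yz.
- move=> _ _ /order_iso_surj[x Ax <-] /order_iso_surj[y Ay <-].
  by have [z zP] := meet _ _ Ax Ay; exists (f z); apply: order_iso_meet.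
- move=> _ _ /order_iso_surj[x Ax <-] /order_iso_surj[y Ay <-].
  by have [z zP] := join _ _ Ax Ay; exists (f z); apply: order_iso_join.
Qed.

Lemma order_iso_lattice_iso : lattice_iso A leA B leB f.
Proof.
split; first by case: fP.
- by move=> *; apply: order_iso_meet.
- by move=> *; apply: order_iso_join.
Qed.
End OrderIso.

(** All isomorphisms are built from the closed sets outwards, so one of them has to be inverted; the
    inverse is obtained by choice, with [x0] as its value off [B]. *)
Lemma order_iso_span {T : choiceType} {U V : Type} (x0 : T)
    (A : set T) leA (B : set U) leB (C : set V) leC f g :
  order_iso A leA B leB f -> order_iso A leA C leC g ->
  exists h, order_iso B leB C leC h.
Proof.
move=> fP gP; pose inv y : T := xget x0 [set x | A x /\ f x = y]%classic.
have invP y : B y -> A (inv y) /\ f (inv y) = y.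
  move=> /(order_iso_surj fP)[x Ax xy].
  exact: (@xgetPex _ x0 [set x | A x /\ f x = y]%classic
            (ex_intro _ x (conj Ax xy))).
have finj x y : A x -> A y -> f x = f y -> x = y.
  by case: fP => -[_ fi _] _ Ax Ay; apply: fi; apply: mem_set.
have ginj x y : A x -> A y -> g x = g y -> x = y.
  by case: gP => -[_ gi _] _ Ax Ay; apply: gi; apply: mem_set.
have invK x : A x -> inv (f x) = x.
  move=> Ax; have [Ai fi] := invP _ (order_iso_fun fP Ax).
  exact: finj.
exists (g \o inv); split; first split.
- by move=> y /= /invP[Ay _]; exact: (order_iso_fun gP).
- move=> x y /set_mem /invP[Ax fx] /set_mem /invP[Ay fy] /= E.
  by rewrite -fx -fy; congr f; apply: ginj.
- move=> z /(order_iso_surj gP)[x Ax <-]; exists (f x) => /=.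
    exact: (order_iso_fun fP).
  by rewrite invK.
- move=> x y /invP[Ax fx] /invP[Ay fy] /=.
  rewrite -{1}fx -{1}fy; split.
    by move=> /(order_iso_le fP Ax Ay) /(order_iso_le gP Ax Ay).
  by move=> /(order_iso_le gP Ax Ay) /(order_iso_le fP Ax Ay).
Qed.

(* [step d i j]: an arrow of the string maps [e_i] to [e_j]; the booleans [d]
   tell which letters are direct. *)
Definition step (d : nat -> bool) n (i j : 'I_n) : bool :=
  (j == i.+1 :> nat) && d i || (i == j.+1 :> nat) && ~~ d j.

Definition closed (d : nat -> bool) n (S : {set 'I_n}) : Prop :=
  forall i j, step d i j -> i \in S -> j \in S.

Section Closed.
Variables (d : nat -> bool) (n : nat).
Implicit Types (i j : 'I_n) (S : {set 'I_n}).

Lemma closed0 : closed d (finset.set0 : {set 'I_n}).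
Proof. by move=> i j _; rewrite inE. Qed.

Lemma closedT : closed d [set: 'I_n].
Proof. by move=> i j _ _; rewrite inE. Qed.

Lemma closedI S S' : closed d S -> closed d S' -> closed d (S :&: S').
Proof.
move=> cS cS' i j ij; rewrite !inE => /andP[/(cS _ _ ij) -> /(cS' _ _ ij)].
exact.
Qed.

Lemma closedU S S' : closed d S -> closed d S' -> closed d (S :|: S').
Proof.
move=> cS cS' i j ij; rewrite !inE.
by case/orP=> [/(cS _ _ ij)|/(cS' _ _ ij)] ->; rewrite ?orbT.
Qed.

Lemma closed_lattice : is_lattice (@closed d n) (fun S S' => S \subset S').
Proof.
split.
- by move=> S _; exact: subxx.
- by move=> S S' _ _ SS' S'S; apply/eqP; rewrite finset.eqEsubset SS'.
- by move=> S S' S'' _ _ _; exact: fintype.subset_trans.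
- move=> S S' cS cS'; exists (S :&: S'); split; first exact: closedI.
  + exact: finset.subsetIl.
  + exact: finset.subsetIr.
  + by move=> X _ XS XS'; rewrite finset.subsetI XS.
- move=> S S' cS cS'; exists (S :|: S'); split; first exact: closedU.
  + exact: finset.subsetUl.
  + exact: finset.subsetUr.
  + by move=> X _ XS XS'; rewrite finset.subUset XS.
Qed.

(* The [n] prevents the subtraction from being truncated. *)
Let height k :=
  (n + count (fun l => ~~ d l) (iota 0 k) - count d (iota 0 k))%N.

(** A direct letter lowers the height by one and an inverse letter raises it by one, so arrows
    always go down and [step] has no cycles. *)
Lemma step_height i j : step d i j -> (height j < height i)%N.
Proof.
have countS (a : pred nat) k : count a (iota 0 k.+1) = (count a (iota 0 k) + a k)%N.
  by rewrite -addn1 iotaD count_cat /= addn0.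
have count_n (k : 'I_n) : (count d (iota 0 k) < n)%N.
  by apply: leq_ltn_trans (ltn_ord k); rewrite -[leqRHS](size_iota 0) count_size.
rewrite /step /height => /orP[]/andP[/eqP jE di];
  move: (count_n i) (count_n j).
- by rewrite jE !countS di /=; lia.
- by rewrite jE !countS (negbTE di) /=; lia.
Qed.

(** A position of least height in the difference can be added: its successors are in [S'] and lower,
    hence already in [S]. *)
Lemma closed_grow S S' : closed d S -> closed d S' -> S \proper S' ->
  exists2 j, j \in S' :\: S & closed d (j |: S).
Proof.
move=> cS cS' /properP[sSS' [j0 j0S' j0S]].
have j0P : j0 \in S' :\: S by rewrite inE j0S.
case: (arg_minnP (fun j : 'I_n => height j) j0P) => j jP jmin.
exists j => // i k ik; rewrite !inE => /orP[/eqP iE|/(cS _ _ ik) ->];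
  last by rewrite orbT.
have kj := step_height ik; rewrite iE in kj ik.
have jS' : j \in S' by case/finset.setDP: jP.
case: (boolP (k \in S)) => [_|kS]; first by rewrite orbT.
have /jmin: k \in S' :\: S by rewrite inE kS (cS' _ _ ik jS').
by rewrite leqNgt kj.
Qed.
End Closed.

(** * Words in the simple reflections *)

Lemma pairwise_cons_split (T : Type) (R : rel T) (s : seq T) :
  (forall s1 x s2, s = s1 ++ x :: s2 -> all (R x) s2) -> pairwise R s.
Proof.
elim: s => //= x s IH sP; rewrite (sP [::] x s) //=.
by apply: IH => s1 y s2 sE; apply: (sP (x :: s1)); rewrite sE.
Qed.

Section CoxeterWords.
Variable n : nat.
Local Open Scope group_scope.
Implicit Types (i j : 'I_n) (r s t : seq 'I_n) (u v : 'S_n.+1).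

Lemma reflection_word_cons i s :
  reflection_word (i :: s) = simple_reflection i * reflection_word s.
Proof. by rewrite /reflection_word big_cons. Qed.

Lemma simple_reflectionC i j : ~~ ((i == j.+1 :> nat) || (j == i.+1 :> nat)) ->
  commute (simple_reflection i) (simple_reflection j).
Proof.
have [->//|ij] := eqVneq i j.
rewrite negb_or => /andP[ij1 ji1]; apply/commgP/conjg_fixP.
rewrite /simple_reflection tpermJ !tpermD //;
  by rewrite -val_eqE /= /bump /=; move: ij; rewrite -val_eqE /=; lia.
Qed.

(** A reflection only exchanges [i] and [i.+1], so the threshold after [k] can be crossed by the
    letter [k] alone. *)
Lemma simple_reflection_le i (k : nat) (x : 'I_n.+1) : i != k :> nat ->
  (simple_reflection i x <= k)%N = (x <= k)%N.
Proof.
move=> ik; rewrite /simple_reflection; case: tpermP => [->|->|//] /=;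
  by rewrite /bump /=; lia.
Qed.

Lemma reflection_word_le s (k : nat) (x : 'I_n.+1) :
  (forall i, i \in s -> i != k :> nat) ->
  (reflection_word s x <= k)%N = (x <= k)%N.
Proof.
elim: s x => [|i s IH] x sk; first by rewrite /reflection_word big_nil perm1.
rewrite reflection_word_cons permM IH.
  by apply/simple_reflection_le/sk/mem_head.
by move=> j js; apply: sk; rewrite inE js orbT.
Qed.

(** The witness is the point that [s] carries to [i]: without the letter [i] it started at or below
    [i], and the letter [i] then lifts it to [i.+1]. *)
Lemma reflection_word_gt s t i : i \notin s -> i \notin t ->
  exists x : 'I_n.+1, (x <= i)%N /\ reflection_word (s ++ i :: t) x =
    reflection_word t (lift ord0 i).
Proof.
move=> si ti; exists ((reflection_word s)^-1 (widen_ord (leqnSn n) i)); split.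
  rewrite -(@reflection_word_le s) ?permKV //= => j js.
  by apply: contraNneq si => /val_inj <-.
rewrite reflection_word_cat permM permKV reflection_word_cons permM.
by rewrite /simple_reflection tpermL.
Qed.

(* A letter occurring exactly once moves a point across the position which
   only that letter can cross. *)
Lemma uniq_word_support s t : uniq s -> reflection_word t = reflection_word s ->
  {subset s <= t}.
Proof.
move=> us ts i /path.splitPr E; case: E us ts => s1 s2.
rewrite cat_uniq /= => /and4P[_ /norP[s1i _] s2i _] ts.
apply/negPn/negP => ti.
have [x [xi xE]] := reflection_word_gt s1i s2i.
have notin r : i \notin r -> forall j, j \in r -> j != i :> nat.
  by move=> ri j jr; apply: contraNneq ri => /val_inj <-.
have := reflection_word_le x (notin _ ti).
by rewrite ts xE (reflection_word_le _ (notin _ s2i)) xi /= /bump /= add1n ltnn.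
Qed.

Lemma coxeter_length_le s : (coxeter_length (reflection_word s) <= size s)%N.
Proof.
rewrite /coxeter_length; case: ex_minnP => m _; apply.
by apply/existsP; exists (in_tuple s).
Qed.

Lemma coxeter_length_word u :
  exists2 s, reflection_word s = u & size s = coxeter_length u.
Proof.
rewrite /coxeter_length; case: ex_minnP => m /existsP[t /eqP tE] _.
by exists t => //; rewrite size_tuple.
Qed.

(** Every word with the same product contains all letters of [s], so it is at least as long. *)
Lemma coxeter_length_uniq s :
  uniq s -> coxeter_length (reflection_word s) = size s.
Proof.
move=> us; apply/eqP; rewrite eqn_leq coxeter_length_le.
have [t ts <-] := coxeter_length_word (reflection_word s).
exact: (uniq_leq_size us (uniq_word_support us ts)).
Qed.

Lemma weak_le1 u : weak_le 1 u.
Proof.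
have -> : 1 = reflection_word [::] :> 'S_n.+1 by rewrite /reflection_word big_nil.
by rewrite /weak_le coxeter_length_uniq // /reflection_word big_nil invg1 mul1g.
Qed.

Lemma weak_le_uniq s t : uniq (s ++ t) ->
  weak_le (reflection_word s) (reflection_word (s ++ t)).
Proof.
move=> st; rewrite /weak_le {2}reflection_word_cat mulKg.
move: (st); rewrite cat_uniq => /and3P[us _ ut].
by rewrite !coxeter_length_uniq // size_cat.
Qed.

(** Shortest words of [u] and of the remaining factor together have the length of [s] and contain
    its letters, so they rearrange it. *)
Lemma weak_leP u s : uniq s -> weak_le u (reflection_word s) ->
  exists t t', [/\ reflection_word t = u, uniq (t ++ t'), t ++ t' =i s &
                   reflection_word (t ++ t') = reflection_word s].
Proof.
move=> us; rewrite /weak_le coxeter_length_uniq // => len.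
have [t tE tl] := coxeter_length_word u.
have [t' t'E t'l] := coxeter_length_word (u^-1 * reflection_word s).
have E : reflection_word (t ++ t') = reflection_word s.
  by rewrite reflection_word_cat tE t'E mulKVg.
exists t, t'; split => //.
- apply: leq_size_uniq us (uniq_word_support us E) _.
  by rewrite size_cat tl t'l len.
- have [|_ st] := uniq_min_size us (uniq_word_support us E).
    by rewrite size_cat tl t'l len.
  by move=> i; rewrite st.
Qed.

(** * Words compatible with the orientation of the string *)

Section Orientation.
Variable d : nat -> bool.

(* The words in which no letter comes before a letter that its closure
   requires: the linear extensions. *)
Definition extends s := uniq s && pairwise (fun i j => ~~ step d i j) s.

Lemma extends_subseq s t : subseq s t -> extends t -> extends s.
Proof.
move=> st /andP[ut pt]; rewrite /extends (subseq_uniq st ut).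
exact: subseq_pairwise st pt.
Qed.

Lemma step_adjacent i j : (i == j.+1 :> nat) || (j == i.+1 :> nat) ->
  step d i j || step d j i.
Proof.
rewrite /step orbC; case/orP => ->; [case: (d i)|case: (d j)];
  by rewrite /= ?andbT ?orbT.
Qed.

(** The first letter [i] of [s] can be moved to the front of [t]: for a letter [b] before it in [t],
    the order in [s] excludes a step from [i] to [b] and the order in [t] one from [b] to [i], so
    the two are not neighbours and commute. *)
Lemma extends_word s t : extends s -> extends t -> s =i t ->
  reflection_word s = reflection_word t.
Proof.
elim: s t => [|i s IH] t es et st.
  case: t st {et} => // j t /(_ j); by rewrite mem_head.
have it : i \in t by rewrite -st mem_head.
move: et st; case/path.splitPr: it => p q et st.
have uis : uniq (i :: s) by case/andP: es.
have upq : uniq (p ++ i :: q) by case/andP: et.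
have {}uis : i \notin s by case/andP: uis.
have ipq : i \notin p ++ q.
  by move: upq; rewrite -cat1s uniq_catCA /= => /andP[].
have spq : s =i p ++ q.
  move=> j; have := st j; rewrite inE !mem_cat inE.
  have [->|//] := eqVneq j i; rewrite ?(negbTE uis).
  by move: ipq; rewrite mem_cat => /negbTE ->.
rewrite reflection_word_cons (IH (p ++ q)) //; first last.
- apply: extends_subseq et; apply: cat_subseq => //; exact: subseq_cons.
- by apply: extends_subseq es; exact: subseq_cons.
rewrite !reflection_word_cat reflection_word_cons !mulgA; congr (_ * _).
have pP b : b \in p -> commute (simple_reflection i) (simple_reflection b).
  move=> bp; apply: simple_reflectionC.
  apply: (contraNN (@step_adjacent i b)); apply/norP; split.
    have bs : b \in s by rewrite spq mem_cat bp.
    by case/andP: es => _ /andP[/allP/(_ _ bs)].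
  case/andP: et => _; rewrite pairwise_cat => /and3P[/allrelP/(_ b i bp)].
  by rewrite mem_head => /(_ isT).
rewrite /reflection_word; elim: p pP {es et st upq ipq spq} => [|b p IHp] pP.
  by rewrite big_nil mulg1 mul1g.
rewrite big_cons mulgA pP ?mem_head // -!mulgA; congr (_ * _).
by apply: IHp => c cp; apply: pP; rewrite inE cp orbT.
Qed.

(* Whether [i] comes before [i.+1] in a word without repetitions can be read
   off its product: only then some [x <= i] is sent above [i.+1]. *)
Lemma word_before_succ s t i j : j = i.+1 :> nat -> uniq (s ++ i :: t) ->
  j \in t -> exists2 x : 'I_n.+1, (x <= i)%N &
    (j < reflection_word (s ++ i :: t) x)%N.
Proof.
move=> jE + jt; rewrite cat_uniq /= => /and4P[_ /norP[si _] it ut].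
have [x [xi xE]] := reflection_word_gt si it; exists x => //; rewrite xE.
move: it ut; case/path.splitPr: jt {xE} => p q it upq.
have jpq : j \notin p ++ q.
  by move: upq; rewrite -cat1s uniq_catCA /= => /andP[].
have ipq : i \notin p ++ q.
  by move: it; rewrite !mem_cat inE !negb_or => /and3P[-> _ ->].
have ne k r : k \notin r -> forall l, l \in r -> l != k :> nat.
  by move=> kr l lr; apply: contraNneq kr => /val_inj <-.
move: jpq ipq; rewrite !mem_cat !negb_or => /andP[jp jq] /andP[ip iq].
have E : reflection_word p (lift ord0 i) = widen_ord (leqnSn n) j.
  apply/val_inj/eqP; rewrite eqn_leq (reflection_word_le _ (ne _ _ jp)) /=.
  rewrite /bump add1n jE leqnn ltnNge (reflection_word_le _ (ne _ _ ip)) /=.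
  by rewrite /bump add1n ltnn.
rewrite reflection_word_cat permM E reflection_word_cons permM.
rewrite /simple_reflection tpermL ltnNge (reflection_word_le _ (ne _ _ jq)) /=.
by rewrite /bump add1n ltnn.
Qed.

(** The word up to [j] lacks the letter [i] and keeps [x] at most [i]; the rest lacks the letter [j]
    and cannot lift it above [j]. *)
Lemma word_after_succ s t i j (x : 'I_n.+1) : j = i.+1 :> nat ->
  uniq (s ++ j :: t) -> i \in t -> (x <= i)%N ->
  (reflection_word (s ++ j :: t) x <= j)%N.
Proof.
move=> jE u it xi; have ne k r : k \notin r -> forall l, l \in r -> l != k :> nat.
  by move=> kr l lr; apply: contraNneq kr => /val_inj <-.
move: u; rewrite cat_uniq /= => /and4P[_ /norP[js st] jt ut].
have is' : i \notin s ++ [:: j].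
  rewrite mem_cat inE negb_or -val_eqE /= jE; apply/andP; split; last by lia.
  by apply: contra st => i_s; apply/hasP; exists i.
rewrite -cat1s catA reflection_word_cat permM (reflection_word_le _ (ne _ _ jt)).
rewrite jE leqW // (reflection_word_le _ (ne _ _ is')) //.
Qed.

Lemma word_order s t p q i j : (i == j.+1 :> nat) || (j == i.+1 :> nat) ->
  uniq (s ++ i :: t) -> j \in t -> uniq (p ++ j :: q) -> i \in q ->
  reflection_word (s ++ i :: t) <> reflection_word (p ++ j :: q).
Proof.
case/orP=> /eqP E u1 jt u2 iq W.
- have [x xj] := word_before_succ E u2 iq.
  by rewrite -W ltnNge (word_after_succ E u1 jt xj).
- have [x xj] := word_before_succ E u1 jt.
  by rewrite W ltnNge (word_after_succ E u2 iq xj).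
Qed.

(** A forbidden pair of [t] consists of neighbours and stands in the opposite order in [s], so by
    [word_order] the two products would differ. *)
Lemma word_extends s t : uniq t -> t =i s -> extends s ->
  reflection_word t = reflection_word s -> extends t.
Proof.
move=> ut ts /andP[us ps] W; rewrite /extends ut /=.
apply: pairwise_cons_split => t1 i t2 tE; apply/allP => j jt2; apply/negP => ij.
have ji : i != j.
  by apply: contraTneq ij => ->; rewrite /step; lia.
have adj : (i == j.+1 :> nat) || (j == i.+1 :> nat).
  by move: ij => /orP[]/andP[->]; rewrite ?orbT.
have : j \in s by rewrite -ts tE mem_cat inE jt2 !orbT.
move=> /path.splitPr sE; case: sE us ps W ts => p q us ps W ts.
have : i \in p ++ j :: q by rewrite -ts tE mem_cat mem_head orbT.
rewrite mem_cat inE (negbTE ji) /= => /orP[ip|iq]; last first.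
  by rewrite tE in ut W; apply: (word_order adj ut jt2 us iq).
move: ps; rewrite pairwise_cat => /and3P[/allrelP/(_ i j ip)].
by rewrite mem_head ij => /(_ isT).
Qed.
Lemma extends_prefix_closed s t : extends (s ++ t) -> (forall i, i \in s ++ t) ->
  closed d [set i in s].
Proof.
move=> /andP[_]; rewrite pairwise_cat => /and3P[/allrelP st _ _] full i j ij.
rewrite !inE => si; apply: contraTT ij => sj; apply: st => //.
by have := full j; rewrite mem_cat (negbTE sj).
Qed.

(** Moving the letters of [S] to the front only creates pairs leading out of [S], and no step leads
    out of a closed set. *)
Lemma extends_filter s (S S' : {set 'I_n}) : extends s -> closed d S ->
  S \subset S' ->
  extends (filter (mem S) s ++ filter (mem (S' :\: S)) s).
Proof.
move=> es cS SS'; have /andP[us ps] := es.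
rewrite /extends cat_uniq !filter_uniq // andbT /=; apply/andP; split.
  by apply/hasPn => i; rewrite !mem_filter !inE => /andP[/andP[/negbTE -> _] _].
rewrite pairwise_cat !(subseq_pairwise (filter_subseq _ _) ps) !andbT.
apply/allrelP => i j; rewrite !mem_filter !inE => /andP[iS _] /andP[/andP[jS _] _].
by apply: contra jS => /cS; apply.
Qed.

Lemma weak_interval_iso s : extends s -> (forall i, i \in s) ->
  order_iso (@closed d n) (fun S S' => S \subset S')
    (weak_interval 1 (reflection_word s)) (@weak_le n)
    (fun S => reflection_word (filter (mem S) s)).
Proof.
move=> es full; have us : uniq s by case/andP: es.
have le S S' : closed d S -> closed d S' -> S \subset S' <->
    weak_le (reflection_word (filter (mem S) s))
            (reflection_word (filter (mem S') s)).
  move=> cS cS'; split=> [SS'|].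
    have e1 := extends_filter es cS SS'.
    have -> : reflection_word (filter (mem S') s) =
        reflection_word (filter (mem S) s ++ filter (mem (S' :\: S)) s).
      apply: extends_word => //; first exact: extends_subseq (filter_subseq _ _) es.
      move=> i; rewrite mem_cat !mem_filter full !andbT !inE.
      by case: (boolP (i \in S)) => //= /(fintype.subsetP SS') ->.
    by apply: weak_le_uniq; case/andP: e1.
  (* A word [t] of the smaller element begins a rearrangement of the word on [S'], and it contains
     all letters of [S] by [uniq_word_support]. *)
  move=> /weak_leP[|t [t' [tE ut ts _]]]; first exact: filter_uniq.
  apply/fintype.subsetP => i iS.
  have /(uniq_word_support (filter_uniq _ us) tE) it : i \in filter (mem S) s.
    by rewrite mem_filter full andbT.
  by have := ts i; rewrite mem_cat it mem_filter => /esym/andP[].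
have fT : filter (mem [set: 'I_n]) s = s.
  by apply/all_filterP/allP => i _; rewrite inE.
split=> [|S S' cS cS']; last exact: le.
split=> [S cS|S S' /set_mem cS /set_mem cS' SS'|u [_ /= /(weak_leP us)]].
- split; first exact: weak_le1.
  by rewrite -[in X in weak_le _ X]fT; apply/le;
    [|exact: closedT|exact: finset.subsetT].
- apply/eqP; rewrite finset.eqEsubset; apply/andP; split; apply/le => //;
    by rewrite SS'; apply/le.
- move=> [t [t' [<- ut tfull W]]].
  (* The rearranged word of sigma is again a linear extension, so the letters of its initial part
     [t] form a closed set. *)
  have et := word_extends ut tfull es W.
  have cS : closed d [set i in t].
    by apply: extends_prefix_closed et _ => i; rewrite tfull.
  exists [set i in t] => //; apply: extends_word.
  + exact: extends_subseq (filter_subseq _ _) es.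
  + exact: extends_subseq (prefix_subseq _ _) et.
  + by move=> i; rewrite mem_filter full andbT /= inE.
Qed.
End Orientation.
End CoxeterWords.

(** * Submodules of the string module *)

Section StringModules.
Local Open Scope ring_scope.
Variables (K : fieldType) (Q : quiver) (I : admissible_ideal K Q).
Variable M : lmodType (GRing.converse (bound_algebra I)).
Implicit Types (m : M) (f g : path_algebra K Q).

Lemma right_actD m f g : right_act m (f + g) = right_act m f + right_act m g.
Proof. by rewrite /right_act -scalerDl /bound_class -bound_piD. Qed.

Lemma right_act0 m : right_act m (0 : path_algebra K Q) = 0.
Proof. by apply: (addrI (right_act m 0)); rewrite -right_actD !addr0. Qed.

Lemma right_actDl m m' f : right_act (m + m') f = right_act m f + right_act m' f.
Proof. by rewrite /right_act scalerDr. Qed.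

Lemma right_act0l f : right_act (0 : M) f = 0.
Proof. by rewrite /right_act scaler0. Qed.

Lemma right_act_suml (J : finType) (P : pred J) (F : J -> M) f :
  right_act (\sum_(i | P i) F i) f = \sum_(i | P i) right_act (F i) f.
Proof.
apply: (big_morph (fun m => right_act m f)) => [m m'|]; first exact: right_actDl.
exact: right_act0l.
Qed.

Lemma right_actA m f g : right_act (right_act m f) g = right_act m (f * g).
Proof. by rewrite /right_act scalerA /bound_class -bound_piM. Qed.

Lemma right_act1 m : right_act m 1 = m.
Proof. by rewrite /right_act; exact: scale1r. Qed.

Lemma path_scaleUU (k c : K) (p : qpath Q) :
  k *: (<< c *g p >> : path_algebra K Q) = << k * c *g p >>.
Proof.
apply/malgP => q; apply: (etrans (mcoeffZ _ _ _)).
apply: (etrans (congr1 ( *%R k) (mcoeffU p c q))).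
exact: (etrans (mulrnAr _ _ _) (esym (mcoeffU p (k * c) q))).
Qed.

Lemma path_scale_one k :
  k *: (1 : path_algebra K Q) = \sum_x << k *g trivial_qpath x >>.
Proof.
rewrite -[1]/(path_one K Q) /path_one scaler_sumr.
by apply: eq_bigr => x _; rewrite path_scaleUU mulr1.
Qed.

(** Together with [path_scale1r] this makes the elements [k *: 1] central, which is why [kscale],
    defined through them, commutes with the action of the algebra. *)
Lemma path_scale1l k f : (k *: (1 : path_algebra K Q)) * f = k *: f.
Proof.
move: f; apply: path_algebra_ext => [g h|g h|c p]; rewrite ?mulrDr ?scalerDr //.
rewrite path_scaleUU path_scale_one -[LHS]/(path_mul _ _) path_mul_suml.
rewrite (bigD1 (qpath_start p)) //= path_mulUU trivial_qpath_cat eqxx.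
rewrite big1 ?addr0 // => x /negbTE xp.
by rewrite path_mulUU trivial_qpath_cat xp.
Qed.

Lemma path_scale1r k f : f * (k *: (1 : path_algebra K Q)) = k *: f.
Proof.
move: f; apply: path_algebra_ext => [g h|g h|c p]; rewrite ?mulrDl ?scalerDr //.
rewrite path_scaleUU path_scale_one -[LHS]/(path_mul _ _) path_mul_sumr.
rewrite (bigD1 (qpath_end p)) //= path_mulUU qpath_cat_trivial eqxx /= mulrC.
rewrite big1 ?addr0 // => x /negbTE xp.
by rewrite path_mulUU qpath_cat_trivial eq_sym xp.
Qed.

Lemma kscale0 m : kscale 0 m = 0.
Proof. by rewrite /kscale scale0r right_act0. Qed.

Lemma kscale1 m : kscale 1 m = m.
Proof. by rewrite /kscale scale1r right_act1. Qed.

Lemma kscaleD (k l : K) m : kscale (k + l) m = kscale k m + kscale l m.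
Proof. by rewrite /kscale scalerDl right_actD. Qed.

Lemma kscaleDr (k : K) m m' : kscale k (m + m') = kscale k m + kscale k m'.
Proof. exact: right_actDl. Qed.

Lemma kscale0r (k : K) : kscale k (0 : M) = 0.
Proof. exact: right_act0l. Qed.

Lemma kscaleA (k l : K) m : kscale k (kscale l m) = kscale (k * l) m.
Proof. by rewrite /kscale right_actA path_scale1r scalerA. Qed.

Lemma right_act_kscale (k : K) m f :
  right_act (kscale k m) f = kscale k (right_act m f).
Proof. by rewrite /kscale !right_actA path_scale1l path_scale1r. Qed.

Lemma right_actU m c (p : qpath Q) :
  right_act m << c *g p >> = kscale c (right_act m << p >>).
Proof. by rewrite /kscale right_actA path_scale1r path_scaleUU mulr1. Qed.

Section Span.
Variables (n : nat) (e : 'I_n -> M).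
Implicit Types S : {set 'I_n}.

Lemma kspan0 S : kspan e S 0.
Proof. by exists (fun=> 0); rewrite big1 // => i _; rewrite kscale0. Qed.

Lemma kspanD S m m' : kspan e S m -> kspan e S m' -> kspan e S (m + m').
Proof.
move=> [c ->] [c' ->]; exists (fun i => c i + c' i).
by rewrite -big_split; apply: eq_bigr => i _; rewrite kscaleD.
Qed.

Lemma kspan_kscale S k m : kspan e S m -> kspan e S (kscale k m).
Proof.
move=> [c ->]; exists (fun i => k * c i).
rewrite (big_morph (kscale k) (kscaleDr k) (kscale0r k)).
by apply: eq_bigr => i _; rewrite kscaleA.
Qed.

Lemma kspan_sum S (J : Type) (r : seq J) (P : pred J) (F : J -> M) :
  (forall i, P i -> kspan e S (F i)) -> kspan e S (\sum_(i <- r | P i) F i).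
Proof. by move=> F_S; elim/big_ind: _ => //; [exact: kspan0|exact: kspanD]. Qed.

Lemma kspan_gen S i : i \in S -> kspan e S (e i).
Proof.
move=> iS; exists (fun j => (j == i)%:R); rewrite (bigD1 i) //= eqxx kscale1.
by rewrite big1 ?addr0 // => j /andP[_ /negbTE ->]; rewrite kscale0.
Qed.

Lemma kspan_submodule S :
  (forall i p, i \in S -> kspan e S (right_act (e i) << p >>)) ->
  is_submodule (kspan e S).
Proof.
move=> eS; split=> [|a m m' [c ->] m'S]; first exact: kspan0.
apply: kspanD => //; have [f ->] := bound_piP a.
rewrite -[_ *: _]/(right_act _ f) right_act_suml; apply: kspan_sum => i iS.
rewrite right_act_kscale; apply: kspan_kscale; rewrite (monalgE f).
rewrite (big_morph (right_act (e i)) (right_actD _) (right_act0 _)).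
by apply: kspan_sum => p _; rewrite right_actU; apply/kspan_kscale/eS.
Qed.

Lemma submodule_right_act (N : set M) m f :
  is_submodule N -> N m -> N (right_act m f).
Proof. by move=> [N0 Nlin] Nm; rewrite -[right_act m f]addr0; apply: Nlin. Qed.
End Span.

Section StringModule.
Variables (x : vertex Q) (w : seq (letter Q)) (e : 'I_(size w).+1 -> M).
Hypothesis M_w : is_string_module x e.
Implicit Types S : {set 'I_(size w).+1}.

(** The value past the end of [w] is an arbitrary default: between two positions of the string
    [step] reads only actual letters. *)
Definition letter_dir (i : nat) : bool :=
  if onth w i is Some l then direct l else true.

(** By uniqueness of coordinates the coefficient of [e i] in itself is 1, while an expansion over a
    set without [i] would make it 0. *)
Lemma kspan_genP S i : kspan e S (e i) -> i \in S.
Proof.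
move=> [c eE]; have [b [_ uniq_b]] := string_module_basis M_w (e i).
have bE (c' : 'I_(size w).+1 -> K) :
    e i = \sum_j kscale (c' j) (e j) -> b i = c' i.
  move=> E; have -> : b = [ffun j => c' j]; last exact: ffunE.
  by apply: uniq_b; rewrite E; apply: eq_bigr => j _; rewrite [in RHS]ffunE.
have b1 : b i = 1.
  apply: (etrans (bE (fun j => (j == i)%:R) _)); last by rewrite eqxx.
  rewrite (bigD1 i) //= eqxx kscale1 big1 ?addr0 // => j /negbTE ->.
  exact: kscale0.
have b2 : b i = if i \in S then c i else 0.
  apply: (bE (fun j => if j \in S then c j else 0)).
  apply: (etrans eE); apply: (etrans (big_mkcond _ _)); apply: eq_bigr => j _.
  by case: ifP => // _; apply/esym/kscale0.
move: b2; rewrite b1; case: ifP => // _ /eqP.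
by rewrite oner_eq0.
Qed.

Lemma kspan_subset S S' : S \subset S' <-> (kspan e S `<=` kspan e S')%classic.
Proof.
split=> [SS' m [c ->]|SS'].
  apply: kspan_sum => i iS; apply/kspan_kscale/kspan_gen.
  exact: (fintype.subsetP SS').
by apply/fintype.subsetP => i iS; apply/kspan_genP/SS'/kspan_gen.
Qed.

Lemma kspan_inj S S' : kspan e S = kspan e S' -> S = S'.
Proof.
move=> E; apply/eqP; rewrite finset.eqEsubset.
by apply/andP; split; apply/kspan_subset; rewrite E.
Qed.

Lemma right_act_arrow (i : 'I_(size w).+1) (b : arrow Q) :
  right_act (e i) << arrow_qpath b >> = 0 \/
  exists2 j, step letter_dir i j & right_act (e i) << arrow_qpath b >> = e j.
Proof.
have lt k l : onth w k = Some l -> (k < size w)%N.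
  by move=> kl; rewrite ltnNge; apply/negP => wk; rewrite onth_default in kl.
have dirE k l : onth w k = Some l -> letter_dir k = l.2.
  by rewrite /letter_dir => ->.
have [wi|wi] := pselect (onth w i = Some (b, true)).
  right; have ij : (i.+1 < (size w).+1)%N by rewrite ltnS (lt _ _ wi).
  exists (Ordinal ij); last exact: (string_module_direct M_w _ wi).
  by rewrite /step /= (dirE _ _ wi) eqxx.
have [[k [ik wk]]|wk] :=
    pselect (exists k, i = k.+1 :> nat /\ onth w k = Some (b, false)).
  right; have jk : (k < (size w).+1)%N by rewrite ltnW // ltnS (lt _ _ wk).
  exists (Ordinal jk);
    last exact: (string_module_inverse M_w (i := Ordinal jk) ik wk).
  by rewrite /step /= ik (dirE _ _ wk) eqxx orbT.
left; apply: (string_module_zero M_w) => // k ik wk'.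
by apply: wk; exists k.
Qed.

Lemma right_act_vertex (i : 'I_(size w).+1) (y : vertex Q) :
  right_act (e i) << trivial_qpath y >> = 0 \/
  right_act (e i) << trivial_qpath y >> = e i.
Proof.
rewrite -{1 2}(string_module_vertex M_w i) right_actA -[_ * _]/(path_mul _ _).
rewrite path_mulUU trivial_qpath_cat.
case: eqP => [E|_]; [right|left].
  have <- : word_vertex x w i = y := E.
  by rewrite mulr1; exact: (string_module_vertex M_w).
exact: right_act0.
Qed.

Lemma right_act_path S (i : 'I_(size w).+1) (p : qpath Q) :
  closed letter_dir S -> i \in S -> kspan e S (right_act (e i) << p >>).
Proof.
move=> cS; case: p => -[y l] lP; elim: l y i lP => [|a l IH] y i lP iS.
  have -> : QPath lP = trivial_qpath y by apply: val_inj.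
  by case: (right_act_vertex i y) => ->; [exact: kspan0|exact: kspan_gen].
have [/eqP ay lP'] : source a == y /\ is_qpath (target a, l) by apply/andP.
have [r rE rv] := @qpath_catP Q (arrow_qpath a) (QPath lP') (erefl _).
have -> : << QPath lP >> =
    (<< arrow_qpath a >> : path_algebra K Q) * << QPath lP' >>.
  rewrite -[RHS]/(path_mul _ _) path_mulUU rE /= mulr1; congr (<< _ >>).
  by apply: val_inj; rewrite rv /= -ay.
rewrite -right_actA; case: (right_act_arrow i a) => [|[j ij]] ->.
  by rewrite right_act0l; exact: kspan0.
exact/IH/(cS _ _ ij).
Qed.

Lemma canonical_submoduleP (N : set M) : canonical_submodules e N <->
  exists2 S, closed letter_dir S & N = kspan e S.
Proof.
split=> [[Nsub [S NE]]|[S cS ->]]; last first.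
  split; last by exists S.
  by apply: kspan_submodule => i p; exact: right_act_path.
exists S => // i j ij iS; subst N; apply: kspan_genP.
suff [b <-] : exists b, right_act (e i) << arrow_qpath b >> = e j.
  by apply: submodule_right_act => //; exact: kspan_gen.
have get (k : nat) : (k < size w)%N -> exists b, onth w k = Some (b, letter_dir k).
  rewrite -onthTE /letter_dir; case: (onth w k) => [[b t] _|//].
  by exists b.
case/orP: ij => /andP[/eqP ijE di].
  have [|b bE] := get i; first by rewrite -ltnS -ijE.
  by exists b; apply: (string_module_direct M_w) => //; rewrite bE di.
have [|b bE] := get j; first by rewrite -ltnS -ijE.
by exists b; apply: (string_module_inverse M_w) => //; rewrite bE (negbTE di).
Qed.

Lemma kspan_set0 : kspan e finset.set0 = [set 0]%classic.
Proof.
apply/seteqP; split=> m /=; last by move=> ->; exact: kspan0.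
by move=> [c ->]; rewrite big_set0.
Qed.

Lemma kspan_setT : kspan e [set: 'I_(size w).+1] = [set: M]%classic.
Proof.
apply/seteqP; split=> m //= _; have [c [-> _]] := string_module_basis M_w m.
by apply: kspan_sum => i _; apply/kspan_kscale/kspan_gen; rewrite inE.
Qed.

(** [closed_grow] puts some [j |: S] between the two ends of the edge; it must be the upper end, and
    then [j] is the label. *)
Lemma hasse_edgeP S (N : set M) i : closed letter_dir S ->
  hasse_edge e (kspan e S) N -> N (e i) -> ~ kspan e S (e i) ->
  closed letter_dir (i |: S) /\ N = kspan e (i |: S).
Proof.
move=> cS [_ /canonical_submoduleP[S' cS' ->] [le ne] cover] /kspan_genP iS' iS.
have {le}SS' : S \subset S' by apply/kspan_subset.
have SpS' : S \proper S'.
  rewrite properE SS'; apply/negP => S'S; apply: ne; congr (kspan e _).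
  by apply/eqP; rewrite finset.eqEsubset SS'.
have [j /finset.setDP[jS' jS] cj] := closed_grow cS cS' SpS'.
have [|||/kspan_inj jE|/kspan_inj jE] := cover (kspan e (j |: S)).
- by apply/canonical_submoduleP; exists (j |: S).
- by apply/kspan_subset; exact: finset.subsetUr.
- by apply/kspan_subset; rewrite finset.subUset finset.sub1set jS'.
- by move: jS; rewrite -jE finset.setU11.
move: iS'; rewrite -jE !inE => /orP[/eqP ->//|/(@kspan_gen _ e) //].
Qed.

Lemma hasse_edge_grow S i : closed letter_dir S -> closed letter_dir (i |: S) ->
  i \notin S -> hasse_edge e (kspan e S) (kspan e (i |: S)).
Proof.
move=> cS ciS iS; split.
- by apply/canonical_submoduleP; exists S.
- by apply/canonical_submoduleP; exists (i |: S).
- split; first by apply/kspan_subset; exact: finset.subsetUr.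
  by move=> /kspan_inj E; rewrite E finset.setU11 in iS.
move=> _ /canonical_submoduleP[L _ ->] /kspan_subset SL /kspan_subset LiS.
case: (boolP (i \in L)) => iL; [right|left]; congr (kspan e _); apply/eqP;
  rewrite finset.eqEsubset ?LiS ?SL ?andbT /=.
  by rewrite finset.subUset finset.sub1set iL.
apply/fintype.subsetP => j jL.
have := fintype.subsetP LiS _ jL; rewrite !inE => /orP[/eqP ji|//].
by rewrite -ji jL in iL.
Qed.

(** When [i] is added, [i |: S] is closed and all later labels lie outside it, so none of them is
    the target of a step from [i]. *)
Lemma labelled_chain_extends S s : closed letter_dir S ->
  labelled_chain e (kspan e S) s ->
  extends letter_dir (map fst s) /\ forall i, (i \in map fst s) = (i \notin S).
Proof.
elim: s S => [|[i N] s IH] S cS /=.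
  rewrite -kspan_setT => /kspan_inj ->; split=> // i.
  by rewrite in_nil inE.
move=> [edge Ni Si]; have [cS' ->] := hasse_edgeP cS edge Ni Si.
move=> /(IH _ cS')[/andP[us ps] mem_s].
have iS : i \notin S by apply/negP => /(@kspan_gen _ e).
split=> [|j]; last first.
  by rewrite inE mem_s !inE negb_or; case: eqVneq => [->|//]; rewrite iS.
rewrite /extends /= mem_s finset.setU11 us ps /= andbT; apply/allP => j.
by rewrite mem_s; apply: contra => /cS'; apply; exact: finset.setU11.
Qed.

Lemma labelled_chain_ex S : closed letter_dir S ->
  exists s, labelled_chain e (kspan e S) s.
Proof.
move: {2}#|~: S| (leqnn #|~: S|) => k; elim: k S => [|k IH] S Sk cS.
  exists [::] => /=; rewrite -kspan_setT; congr (kspan e _).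
  by apply/eqP; rewrite -finset.subTset -finset.setCS finset.setCT finset.subset0
    -cards_eq0 -leqn0.
have [->|ST] := eqVneq S [set: _]; first by exists [::]; exact: kspan_setT.
have [|j /finset.setDP[_ jS] cj] := closed_grow cS (@closedT letter_dir _).
  by rewrite finset.properT.
have [|s chain] := IH (j |: S) _ cj.
  rewrite -ltnS; apply: leq_trans Sk; apply: proper_card.
  apply/properP; split; first by rewrite finset.setCS finset.subsetUr.
  by exists j; rewrite !inE ?eqxx.
exists ((j, kspan e (j |: S)) :: s) => /=; split=> //.
- exact: hasse_edge_grow.
- by apply: kspan_gen; exact: finset.setU11.
- by move=> /kspan_genP jS'; rewrite jS' in jS.
Qed.

(** Which chain [xget] picks is unknown, but some chain exists and the labels of every chain have
    these properties. *)
Lemma associated_coxeter_word : exists s, [/\ extends letter_dir s,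
  forall i, i \in s & associated_coxeter e = reflection_word s].
Proof.
have [s0 s0P] := labelled_chain_ex (@closed0 letter_dir _).
rewrite kspan_set0 in s0P; rewrite /associated_coxeter; set X := mkset _.
have : X (xget 1%g X) by apply: (@xgetPex _ _ X); eexists; exists s0.
move=> [s chain ->]; rewrite -kspan_set0 in chain.
have [es full] := labelled_chain_extends (@closed0 _ _) chain.
by exists (map fst s); split=> // i; rewrite full inE.
Qed.

Lemma canonical_submodules_iso :
  order_iso (@closed letter_dir (size w).+1) (fun S S' => S \subset S')
    (canonical_submodules e) (@submodule_le K Q I M) (kspan e).
Proof.
split=> [|S S' _ _]; last exact: kspan_subset.
split=> [S cS|S S' _ _|N /canonical_submoduleP[S cS ->]].
- by apply/canonical_submoduleP; exists S.
- exact: kspan_inj.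
- by exists S.
Qed.
End StringModule.
End StringModules.

(** * Matchings of the snake graph *)

Section Squares.
Local Open Scope ring_scope.
Implicit Types (c v : square) (s : segment).

Definition left_of c : square := (c.1 - 1, c.2).
Definition below c : square := (c.1, c.2 - 1).
Definition right_of c : square := (c.1 + 1, c.2).
Definition above c : square := (c.1, c.2 + 1).

Lemma right_ofK c : left_of (right_of c) = c.
Proof. by case: c => a b; rewrite /left_of /= addrK. Qed.

Lemma aboveK c : below (above c) = c.
Proof. by case: c => a b; rewrite /below /= addrK. Qed.

Lemma left_ofK c : right_of (left_of c) = c.
Proof. by case: c => a b; rewrite /right_of /= subrK. Qed.

Lemma belowK c : above (below c) = c.
Proof. by case: c => a b; rewrite /above /= subrK. Qed.

(* The two squares adjacent to a segment [s] are [s.1] and [lower s]. *)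
Definition lower s : square := if s.2 then below s.1 else left_of s.1.

Lemma sidesE c s : sides c s <-> s.1 = c \/ lower s = c.
Proof.
rewrite /sides /lower; split.
  by move=> [[]|[]] -> /=;
    [left|right; rewrite aboveK|left|right; rewrite right_ofK].
case: s => v [] /= [vE|vE].
- by left; left; rewrite vE.
- by left; right; rewrite -vE -/(above (below v)) belowK.
- by right; left; rewrite vE.
- by right; right; rewrite -vE -/(right_of (left_of v)) left_ofK.
Qed.

Lemma lower_neq s : lower s != s.1.
Proof.
case: s => -[a b] []; rewrite /lower /below /left_of /= xpair_eqE ?eqxx /=;
  by rewrite ?andbT; lia.
Qed.

(** Constant on antidiagonals; on the snake it recovers the number of a tile. *)
Definition level c : int := c.1 + c.2.
Definition parity c : bool := odd `|level c|.

Lemma parity_left_of c : parity (left_of c) = ~~ parity c.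
Proof. by case: c => a b; rewrite /parity /level /=; lia. Qed.

Lemma parity_below c : parity (below c) = ~~ parity c.
Proof. by case: c => a b; rewrite /parity /level /=; lia. Qed.

Lemma incidentE v s : incident v s <->
  [\/ s = (v, true), s = (v, false), s = (left_of v, true) | s = (below v, false)].
Proof.
rewrite /incident; split; last first.
  case=> -> /=; [by left|by left| |]; right.
    by rewrite -/(right_of (left_of v)) left_ofK.
  by rewrite -/(above (below v)) belowK.
case: s => u [] [/= ->|/= ->].
- exact: Or41.
- by apply: Or43; rewrite -/(right_of u) right_ofK.
- exact: Or42.
- by apply: Or44; rewrite -/(above u) aboveK.
Qed.

Definition degree (P : segment -> bool) v : nat :=
  P (v, true) + P (v, false) + P (left_of v, true) + P (below v, false).

Lemma degree1P (P : segment -> bool) v :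
  (exists! s, P s /\ incident v s) <-> degree P v = 1%N.
Proof.
have ne1 : left_of v <> v by apply/eqP; apply: (lower_neq (v, false)).
have ne2 : below v <> v by apply/eqP; apply: (lower_neq (v, true)).
have I1 : incident v (v, true) by apply/incidentE; exact: Or41.
have I2 : incident v (v, false) by apply/incidentE; exact: Or42.
have I3 : incident v (left_of v, true) by apply/incidentE; exact: Or43.
have I4 : incident v (below v, false) by apply/incidentE; exact: Or44.
rewrite /degree; split=> [[s [[Ps vs] s_uniq]]|].
  have {}s_uniq t : P t -> incident v t -> s = t by move=> Pt vt; apply: s_uniq.
  have F t : incident v t -> s <> t -> P t = false.
    by move=> vt st; apply/negP => /s_uniq/(_ vt).
  move/incidentE: vs => [] sE; rewrite sE in Ps F *; rewrite Ps.
  + by rewrite !F // => -[] // /esym.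
  + by rewrite !F // => -[] // /esym.
  + by rewrite !F // => -[] //.
  + by rewrite !F // => -[] //.
move=> deg1.
have get s : P s -> incident v s -> (forall t, P t -> incident v t -> s = t) ->
  exists! s, P s /\ incident v s 
  by move=> Ps vs H; exists s; split=> // t [Pt vt]; exact: H.
move: deg1; case E1: (P (v, true)); case E2: (P (v, false));
  case E3: (P (left_of v, true)); case E4: (P (below v, false)) => // _;
  [apply: (get (v, true))|apply: (get (v, false))
  |apply: (get (left_of v, true))|apply: (get (below v, false))] => //;
  by move=> t /[swap] /incidentE[] ->; rewrite ?E1 ?E2 ?E3 ?E4.
Qed.
End Squares.

(** * Positions of the tiles and of their neighbours *)

Section Tiles.
Local Open Scope ring_scope.
Variables (Q : quiver) (w : seq (letter Q)).
Local Notation n := (size w).+1.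
Local Notation dir := (letter_dir w).
Implicit Types (i j : 'I_n) (c v : square) (s : segment) (S : {set 'I_n}).

(** A zigzag changes the gluing and keeps the direction, a straight piece does the reverse. So the
    sum of both mod 2 alternates along the word, starting from 0. *)
Definition glue (i : nat) : bool := dir i (+) odd i.

Lemma gluings_afterE (d g : bool) (l : seq bool) (i : nat) :
  (i < size l)%N ->
  nth true (gluings_after g d l) i = nth true l i (+) ~~ (d (+) g) (+) odd i.
Proof.
elim: l d g i => [//|d' l IH] d g; case=> [_|i il] /=.
  by case: d; case: d'; case: g.
rewrite IH //.
by case: (nth _ _ _) (odd i) d d' g {il} => [] [] [] [] [].
Qed.

Lemma size_gluings (l : seq bool) : size (gluings l) = size l.
Proof.
case: l => //= d l; congr _.+1.
by elim: l d {1}d => //= d' l IH d g; rewrite IH.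
Qed.

Lemma nth_gluings (i : nat) : (i < size w)%N ->
  nth true (gluings (map (@direct Q) w)) i = glue i.
Proof.
move=> iw; have -> : glue i = nth true (map (@direct Q) w) i (+) odd i.
  rewrite /glue /letter_dir; congr (_ (+) _).
  by elim: w i iw => //= l w' IH [|i] //= /IH.
case: w iw => //= l w' ; case: i => [_|i]; first by rewrite addbF.
rewrite ltnS => iw; rewrite /= gluings_afterE ?size_map // addbb.
by case: (nth _ _ _) (odd i) => [] [].
Qed.

Definition tile_x k : nat := count id (take k (gluings (map (@direct Q) w))).
Definition tile_y k : nat := count negb (take k (gluings (map (@direct Q) w))).

Lemma tileE i : tile i = ((tile_x i)%:Z, (tile_y i)%:Z).
Proof. by []. Qed.

Lemma tile_xS k : (k < size w)%N -> tile_x k.+1 = (tile_x k + glue k)%N.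
Proof.
move=> kw; rewrite /tile_x (take_nth true) ?size_gluings ?size_map //.
by rewrite -cats1 count_cat /= addn0 nth_gluings.
Qed.

Lemma tile_yS k : (k < size w)%N -> tile_y k.+1 = (tile_y k + ~~ glue k)%N.
Proof.
move=> kw; rewrite /tile_y (take_nth true) ?size_gluings ?size_map //.
by rewrite -cats1 count_cat /= addn0 nth_gluings.
Qed.

Lemma tile_xy k : (k <= size w)%N -> (tile_x k + tile_y k)%N = k.
Proof.
elim: k => [|k IH] kw; first by rewrite /tile_x /tile_y take0.
rewrite tile_xS // tile_yS // -[in RHS](IH (ltnW kw)).
by case: (glue k); rewrite /= ?addn0 ?addn1 ?addSn ?addnS.
Qed.

Lemma tile_x_le j k : (j <= k)%N -> (k <= size w)%N -> (tile_x j <= tile_x k)%N.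
Proof.
move=> jk; elim: k jk => [|k IH]; first by rewrite leqn0 => /eqP ->.
rewrite leq_eqVlt => /orP[/eqP -> //|jk kw].
by rewrite tile_xS // (leq_trans (IH jk (ltnW kw))) ?leq_addr.
Qed.

Lemma tile_y_le j k : (j <= k)%N -> (k <= size w)%N -> (tile_y j <= tile_y k)%N.
Proof.
move=> jk; elim: k jk => [|k IH]; first by rewrite leqn0 => /eqP ->.
rewrite leq_eqVlt => /orP[/eqP -> //|jk kw].
by rewrite tile_yS // (leq_trans (IH jk (ltnW kw))) ?leq_addr.
Qed.

Lemma level_tile i : level (tile i) = i%:Z.
Proof. by rewrite /level /= -PoszD; congr Posz; exact: tile_xy (leq_ord i). Qed.

Lemma parity_tile i : parity (tile i) = odd i.
Proof. by rewrite /parity level_tile. Qed.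

Lemma tile_inj : injective (@tile Q w).
Proof.
by move=> i j ij; apply: val_inj; apply/eqP; rewrite -eqz_nat -!level_tile ij.
Qed.

Definition tile_in S c : bool := [exists i in S, tile i == c].
Local Notation is_tile := (tile_in [set: 'I_n]).

Lemma tile_inP S c : reflect (exists2 i, i \in S & tile i = c) (tile_in S c).
Proof.
by apply: (iffP exists_inP) => -[i iS /eqP ic]; exists i => //; apply/eqP.
Qed.

Lemma is_tileP c : reflect (exists i, tile i = c) (is_tile c).
Proof.
by apply: (iffP (tile_inP _ _)) => [[i _ ic]|[i ic]]; exists i; rewrite ?inE.
Qed.

Lemma tile_in_tile S i : tile_in S (tile i) = (i \in S).
Proof.
by apply/tile_inP/idP => [[j jS /tile_inj <-//]|iS]; exists i.
Qed.

Lemma is_tile_tile i : is_tile (tile i).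
Proof. by rewrite tile_in_tile inE. Qed.

Lemma tile_in_is_tile S c : tile_in S c -> is_tile c.
Proof. by move=> /tile_inP[i _ <-]; exact: is_tile_tile. Qed.

Lemma tile_in0 c : tile_in finset.set0 c = false.
Proof. by apply/tile_inP; case=> i; rewrite inE. Qed.

Lemma tile_inU1 S i c : i \notin S ->
  tile_in (i |: S) c = (tile i == c) (+) tile_in S c.
Proof.
move=> iS; case: eqP => [<-|ic].
  by rewrite !tile_in_tile finset.setU11 (negbTE iS).
apply/tile_inP/tile_inP => -[j jS jc]; exists j => //.
  by move: jS; rewrite !inE => /orP[/eqP ji|//]; rewrite ji in jc.
by rewrite inE jS orbT.
Qed.

Lemma is_tile_level c c' : is_tile c -> is_tile c' -> level c = level c' -> c = c'.
Proof.
move=> /is_tileP[i <-] /is_tileP[j <-]; rewrite !level_tile => -[ij].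
by congr tile; apply: val_inj.
Qed.

Lemma is_tile_ge0 c : is_tile c -> 0 <= c.1 /\ 0 <= c.2.
Proof. by move=> /is_tileP[i <-]. Qed.

(** The two squares have the same level, and each level holds at most one tile. *)
Lemma left_below_tile c : ~~ (is_tile (left_of c) && is_tile (below c)).
Proof.
apply/negP => /andP[l b]; have := is_tile_level l b; case: c {l b} => a b.
rewrite /level /left_of /below /= addrA addrAC => /(_ erefl) [].
by lia.
Qed.

Lemma tile_step i j : j = i.+1 :> nat ->
  if glue i then left_of (tile j) = tile i else below (tile j) = tile i.
Proof.
move=> ji; have iw : (i < size w)%N by rewrite -ltnS -ji.
rewrite !tileE ji tile_xS // tile_yS //; rewrite /left_of /below /=.
by case: (glue i) => /=; congr pair; lia.
Qed.

Lemma step_left i j : left_of (tile j) = tile i -> j = i.+1 :> nat /\ glue i.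
Proof.
move=> ji; have jE : j = i.+1 :> nat.
  have := level_tile i; rewrite -ji /level /= -addrA (addrC (-1)) addrA.
  by rewrite -/(level (tile j)) level_tile; lia.
split=> //; have := tile_step jE; case: (glue i) => //; rewrite -ji.
by rewrite /below /left_of => -[]; lia.
Qed.

Lemma step_below i j : below (tile j) = tile i -> j = i.+1 :> nat /\ ~~ glue i.
Proof.
move=> ji; have jE : j = i.+1 :> nat.
  have := level_tile i; rewrite -ji /level /= addrA.
  by rewrite -/(level (tile j)) level_tile; lia.
split=> //; have := tile_step jE; case: (glue i) => //; rewrite -ji.
by rewrite /below /left_of => -[]; lia.
Qed.

(** The numbers of the two tiles differ by 2, and the tile numbered between them is glued to [v]
    from the left or from below. *)
Lemma tile_between v : is_tile v -> is_tile (left_of (below v)) ->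
  is_tile (left_of v) || is_tile (below v).
Proof.
move=> /is_tileP[j <-] /is_tileP[i iE].
have jE : j = i.+2 :> nat.
  have := level_tile i; rewrite iE /level /= addrACA.
  by rewrite -/(level (tile j)) level_tile; lia.
have kn : (i.+1 < n)%N by rewrite ltnW // -jE.
have := @tile_step (Ordinal kn) j jE.
by case: ifP => _ ->; rewrite is_tile_tile ?orbT.
Qed.

(* A tile of the snake is followed by a tile to its right iff its letter is
   direct and its index is even, or inverse and odd; hence the dependence on
   the parity. *)
Lemma closed_tileP S : closed dir S <-> (forall v,
  (is_tile v -> is_tile (left_of v) ->
     if parity v then tile_in S (left_of v) -> tile_in S v
     else tile_in S v -> tile_in S (left_of v)) /\
  (is_tile v -> is_tile (below v) ->
     if parity v then tile_in S v -> tile_in S (below v)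
     else tile_in S (below v) -> tile_in S v)).
Proof.
split=> [cS v|cS i j].
  split=> /is_tileP[j <-] /is_tileP[i iE]; rewrite -iE !tile_in_tile parity_tile.
    have [jE] := step_left (esym iE); rewrite /glue jE /=.
    case: (odd i) => /=; rewrite ?addbT ?addbF => di; apply: cS;
      by rewrite /step jE eqxx ?di ?orbT.
  have [jE] := step_below (esym iE); rewrite /glue jE /=.
  case: (odd i) => /=; rewrite ?addbT ?addbF ?negbK => di; apply: cS;
    by rewrite /step jE eqxx ?di ?orbT.
have rel (k l : 'I_n) : l = k.+1 :> nat ->
    if dir k then k \in S -> l \in S else l \in S -> k \in S.
  move=> lk; have := tile_step lk; rewrite /glue; have [cl cb] := cS (tile l).
  have lv : odd l = ~~ odd k by rewrite lk.
  case: ifP => [+ kl|+ kl]; [move: cl|move: cb];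
    rewrite kl !is_tile_tile => /(_ isT isT); rewrite parity_tile lv !tile_in_tile;
    by case: (dir k); case: (odd k).
by case/orP=> /andP[/eqP /rel]; case: (dir _).
Qed.
End Tiles.

(** * Perfect matchings and closed sets of tiles *)

Section Matchings.
Local Open Scope ring_scope.
Variables (Q : quiver) (w : seq (letter Q)).
Local Notation n := (size w).+1.
Local Notation dir := (letter_dir w).
Local Notation is_tile := (@tile_in Q w [set: 'I_n]).
Implicit Types (i j : 'I_n) (c v : square) (s : segment) (S : {set 'I_n}).
Implicit Types (P : segment -> bool) (eps : bool).

Lemma snake_edgesE s : snake_edges w s <-> is_tile s.1 || is_tile (lower s).
Proof.
split=> [[i /sidesE[->|->]]|]; rewrite ?is_tile_tile ?orbT //.
by case/orP=> /is_tileP[i iE]; exists i; apply/sidesE; [left|right].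
Qed.

Definition touches v : bool :=
  [|| is_tile v, is_tile (left_of v), is_tile (below v)
    | is_tile (left_of (below v))].

Lemma snake_verticesE v : snake_vertices w v <-> touches v.
Proof.
rewrite /touches; split=> [[s /snake_edgesE + /incidentE vs]|].
  by case: vs => -> /orP[] /= ->; rewrite ?orbT.
case/or4P=> t; [exists (v, true)|exists (v, false)|exists (v, true)
               |exists (below v, false)];
  rewrite ?snake_edgesE ?incidentE /= ?t ?orbT //;
  by [exact: Or41|exact: Or42|exact: Or44].
Qed.

Lemma perfect_matchingsE P : perfect_matchings w [set s | P s]%classic <->
  (forall s, P s -> is_tile s.1 || is_tile (lower s)) /\
  (forall v, touches v -> degree P v = 1%N).
Proof.
split=> -[PE Pv]; split.
- by move=> s Ps; apply/snake_edgesE/PE.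
- by move=> v /snake_verticesE/Pv/degree1P.
- by move=> s /= /PE/snake_edgesE.
- by move=> v /snake_verticesE/Pv/degree1P.
Qed.

(* On a segment of the boundary the first term is the matching of the boundary
   whose sides of the tile number [i] are horizontal iff [i] is odd (even when
   [eps] holds, which is only needed for a single tile, where P_min is either
   matching); the other two terms exchange the sides of the tiles in [S], a
   segment between two tiles of [S] being exchanged twice. *)
Definition snake_matching eps S s : bool :=
  (is_tile s.1 (+) is_tile (lower s)) &&
    (s.2 (+) parity s.1 (+) is_tile s.1 (+) eps)
  (+) (tile_in S s.1 (+) tile_in S (lower s)).

Lemma no_eps eps c c' : (eps -> size w = 0%N) ->
  is_tile c -> is_tile c' -> c != c' -> ~~ eps.
Proof.
move=> eps0 /is_tileP[i <-] /is_tileP[j <-]; apply: contra => /eps0 w0.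
apply/eqP; congr tile; apply: val_inj.
by move: (ltn_ord i) (ltn_ord j) => /=; lia.
Qed.

(** The degree depends only on the four squares around [v]: which are tiles, which lie in [S], and
    the parity. The shape of the snake and closedness across shared segments restrict these data,
    and a finite check remains. *)
Lemma snake_matching_degree eps S v : closed dir S ->
  (eps -> size w = 0%N) -> touches v -> degree (snake_matching eps S) v = 1%N.
Proof.
move=> cS eps0 + ; have pair c c' := @no_eps _ c c' eps0.
have pairl c : is_tile c -> is_tile (left_of c) -> ~~ eps.
  by move=> tc tl; apply: (pair _ _ tl tc); exact: (lower_neq (c, false)).
have pairb c : is_tile c -> is_tile (below c) -> ~~ eps.
  by move=> tc tl; apply: (pair _ _ tl tc); exact: (lower_neq (c, true)).
rewrite /touches /degree /snake_matching /lower /=.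
rewrite -/(left_of (below v)) -[below (left_of v)]/(left_of (below v)).
move/closed_tileP in cS; have [cl cb] := cS v; have [cl' _] := cS (below v).
have [_ cb'] := cS (left_of v).
rewrite -[below (left_of v)]/(left_of (below v)) !parity_left_of in cb' *.
move: cl cb cl' cb' (pairl v) (pairb v) (pairl (below v)) (pairb (left_of v)).
rewrite -[below (left_of v)]/(left_of (below v)) !parity_below.
move: (left_below_tile w v) (@tile_between Q w v).
have := tile_in_is_tile (S := S) (c := v).
have := tile_in_is_tile (S := S) (c := left_of v).
have := tile_in_is_tile (S := S) (c := below v).
have := tile_in_is_tile (S := S) (c := left_of (below v)).
move: (is_tile v) (is_tile (left_of v)) (is_tile (below v)) => t1 t2 t3.
move: (is_tile (left_of (below v))) (tile_in S v) => t4 s1.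
move: (tile_in S (left_of v)) (tile_in S (below v)) => s2 s3.
move: (tile_in S (left_of (below v))) (parity v) => s4 p.
clear.
by case: t1; case: t2; case: t3; case: t4 => //=; case: s1; case: s2;
  case: s3; case: s4 => //=; case: p; case: eps => //=; intuition.
Qed.
Lemma snake_matching_perfect eps S : closed dir S ->
  (eps -> size w = 0%N) ->
  perfect_matchings w [set s | snake_matching eps S s]%classic.
Proof.
move=> cS eps0; apply/perfect_matchingsE; split=> [s|v].
  rewrite /snake_matching.
  have := tile_in_is_tile (S := S) (c := s.1).
  have := tile_in_is_tile (S := S) (c := lower s).
  by case: (is_tile s.1); case: (is_tile (lower s)) => //=;
    case: (tile_in S s.1); case: (tile_in S (lower s)) => //=; intuition.
exact: snake_matching_degree.
Qed.

(** The degree at one end of a shared segment already forces the implication between its two tiles: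
    of the other two squares at this point [left_below_tile] excludes one. *)
Lemma snake_matching_closed eps S : (eps -> size w = 0%N) ->
  (forall v, touches v -> degree (snake_matching eps S) v = 1%N) -> closed dir S.
Proof.
move=> eps0 deg; apply/closed_tileP => v.
split=> tv tl; have := deg v; rewrite /touches tv tl ?orbT => /(_ isT);
  [have eps1 := no_eps eps0 tl tv (lower_neq (v, false))
  |have eps1 := no_eps eps0 tl tv (lower_neq (v, true))];
  move: (left_below_tile w v); rewrite tl /= ?andbT => tb;
  have := tile_in_is_tile (S := S) (c := below v);
  have := tile_in_is_tile (S := S) (c := left_of v);
  rewrite (negbTE tb) /degree /snake_matching /lower /= tv tl;
  rewrite (negbTE tb) (negbTE eps1) /=;
  case: (tile_in S v); case: (tile_in S (left_of v));
  case: (tile_in S (below v)); case: (parity v) => //=;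
  intuition; lia.
Qed.

(** * Even sets of segments as boundaries mod 2 *)

Section EvenSets.
Variable D : segment -> bool.
Hypothesis D_tile : forall s, D s -> is_tile s.1 || is_tile (lower s).
Hypothesis D_even : forall v, ~~ odd (degree D v).

(* The parity of the number of segments of [D] crossed when going from [c] to
   the left until infinity. *)
Definition crossings c : bool :=
  if c.1 is Posz k then \big[addb/false]_(j < k.+1) D ((j%:Z, c.2), false)
  else false.

Lemma D_ge0 s : D s -> 0 <= s.1.1 /\ 0 <= s.1.2.
Proof.
move=> /D_tile; case: s => -[a b] [];
  by case/orP=> /is_tile_ge0; rewrite /lower /=; lia.
Qed.

Lemma crossings_left c : crossings c = D (c, false) (+) crossings (left_of c).
Proof.
case: c => -[[|k]|k] b.
- by rewrite /crossings /= big_ord1 addbF.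
- have -> : left_of (k.+1%:Z, b) = (k%:Z, b) by congr pair; rewrite /=; lia.
  by rewrite /crossings /= big_ord_recr /= addbC.
- have -> : left_of (Negz k, b) = (Negz k.+1, b) by congr pair; rewrite /=; lia.
  by rewrite /crossings /= addbF; apply/esym/negP => /D_ge0[].
Qed.

Lemma crossings_neg c : (c.1 < 0) || (c.2 < 0) -> crossings c = false.
Proof.
case: c => -[k|k] b //=; rewrite /crossings /= => b0.
by rewrite big1 // => j _; apply/negP => /D_ge0[] /= _; rewrite leNgt b0.
Qed.

(* By induction on the diagonals: the even degree of the bottom left corner of
   [c] makes the crossings through the left and the bottom side of [c] agree,
   and off the snake one of these sides is not in [D] and separates [c] from
   another square off the snake. *)
Lemma crossings_below_out (m : nat) c : level c < m ->
  crossings c = D (c, true) (+) crossings (below c) /\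
  (~~ is_tile c -> crossings c = false).
Proof.
elim: m c => [|m IH] c cm.
  have neg : (c.1 < 0) || (c.2 < 0) by move: cm; rewrite /level; lia.
  rewrite !crossings_neg //=; last by move: neg; lia.
  split=> //; rewrite addbF; apply/esym/negP => /D_ge0 /=; lia.
have [IHl Il] := IH (left_of c) ltac:(move: cm; rewrite /level /=; lia).
have [_ Ib] := IH (below c) ltac:(move: cm; rewrite /level /=; lia).
have cb : crossings c = D (c, true) (+) crossings (below c).
  rewrite crossings_left IHl (crossings_left (below c)).
  rewrite -[below (left_of c)]/(left_of (below c)).
  move: (D_even c); rewrite /degree !oddD !oddb.
  case: (D _); case: (D _); case: (D _); case: (D _) => //=;
  by case: (crossings _).
split=> // tc; case/nandP: (left_below_tile w c) => [tl|tb].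
  rewrite crossings_left Il // addbF; apply/negP => /D_tile.
  by rewrite /lower /= (negbTE tc) (negbTE tl).
rewrite cb Ib // addbF; apply/negP => /D_tile.
by rewrite /lower /= (negbTE tc) (negbTE tb).
Qed.

(** [S] collects the tiles with odd crossings: this parity vanishes off the snake and changes
    exactly across the segments of [D]. *)
Lemma even_boundary : exists S, forall s,
  D s = tile_in S s.1 (+) tile_in S (lower s).
Proof.
have cr c : crossings c = D (c, true) (+) crossings (below c) /\
    (~~ is_tile c -> crossings c = false).
  by apply: (crossings_below_out (m := `|level c|.+1)); lia.
pose S := [set i | crossings (@tile Q w i)]%SET; exists S => s.
have E c : tile_in S c = crossings c.
  case: (boolP (is_tile c)) => [/is_tileP[i <-]|tc].
    by rewrite tile_in_tile inE.
  rewrite (snd (cr c)) //; apply: contraNF tc; exact: tile_in_is_tile.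
rewrite !E; case: s => c []; rewrite /lower /=.
  by rewrite (proj1 (cr c)) addbK.
by rewrite crossings_left addbK.
Qed.
End EvenSets.

Lemma snake_matchingS eps S s : snake_matching eps S s =
  snake_matching eps finset.set0 s (+) (tile_in S s.1 (+) tile_in S (lower s)).
Proof. by rewrite /snake_matching !tile_in0 !addbF. Qed.

Lemma perfect_matching_snake eps P : (eps -> size w = 0%N) ->
  perfect_matchings w [set s | P s]%classic ->
  exists2 S, closed dir S & P =1 snake_matching eps S.
Proof.
move=> eps0 PP; have /perfect_matchingsE[PE Pdeg] := PP.
have /perfect_matchingsE[ME Mdeg] :=
  snake_matching_perfect (@closed0 dir n) eps0.
pose R := snake_matching eps finset.set0.
have [||S DS] := @even_boundary (fun s => P s (+) R s).
- by move=> s; case Ps: (P s); [rewrite PE|move=> /= /ME].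
(* Both degrees are 1 at the points of the snake and 0 elsewhere. *)
- move=> v; have deg2 : odd (degree P v) = odd (degree R v).
    case: (boolP (touches v)) => [tv|]; first by rewrite Pdeg // Mdeg.
    rewrite /touches !negb_or => /and4P[t1 t2 t3 t4].
    have F (X : segment -> bool) :
        (forall s, X s -> is_tile s.1 || is_tile (lower s)) -> degree X v = 0%N.
      move=> XE; have G s : ~~ is_tile s.1 -> ~~ is_tile (lower s) -> X s = false.
        by move=> s1 s2; apply/negP => /XE; rewrite (negbTE s1) (negbTE s2).
      by rewrite /degree !G.
    by rewrite !F.
  move: deg2; rewrite /degree !oddD !oddb.
  move: (R) => {}R.
  by case: (P (v, true)) (P (v, false)) (P (left_of v, true))
    (P (below v, false)) (R (v, true)) (R (v, false)) (R (left_of v, true))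
    (R (below v, false)); do 7!case.
have PS : P =1 snake_matching eps S.
  by move=> s; rewrite snake_matchingS -DS addbC addbK.
exists S => //; apply: (snake_matching_closed eps0) => v tv.
by rewrite -(Pdeg v tv) /degree !PS.
Qed.
End Matchings.

(** * The minimal matching, enclosed tiles and rotations *)

Section MatchingLattice.
Local Open Scope ring_scope.
Variables (Q : quiver) (w : seq (letter Q)).
Local Notation n := (size w).+1.
Local Notation dir := (letter_dir w).
Local Notation tile_in := (@tile_in Q w).
Local Notation is_tile := (tile_in [set: 'I_n]).
Local Notation tile := (@tile Q w).
Local Notation snake_matching := (@snake_matching Q w).
Implicit Types (i j : 'I_n) (c v : square) (s : segment) (S : {set 'I_n}).
Implicit Types (P : segment -> bool) (eps h : bool).

(** Inverse to [lower]: the sides of [c] with orientation [h] are [(c, h)] and [(beyond h c, h)]. *)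
Definition beyond h c : square := if h then above c else right_of c.

Lemma lower_beyond h c : lower (beyond h c, h) = c.
Proof. by case: h; rewrite /lower /= ?aboveK ?right_ofK. Qed.

Lemma parity_lower s : parity (lower s) = ~~ parity s.1.
Proof. by rewrite /lower; case: s.2; rewrite ?parity_below ?parity_left_of. Qed.

Lemma parity_beyond h c : parity (beyond h c) = ~~ parity c.
Proof. by rewrite -{2}(lower_beyond h c) parity_lower negbK. Qed.

Lemma sides_beyond c s : sides c s <-> s = (c, s.2) \/ s = (beyond s.2 c, s.2).
Proof.
rewrite sidesE; split=> [[<-|<-]|[->|->]].
- by left; case: s.
- by right; case: s => v []; rewrite /beyond /lower /= ?belowK ?left_ofK.
- by left.
- by right; rewrite lower_beyond.
Qed.

Lemma boundary_edgeE s : boundary_edge w s <-> is_tile s.1 (+) is_tile (lower s).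
Proof.
split=> [[i [/sidesE is_i i_uniq]]|].
  have iuniq c : is_tile c -> s.1 = c \/ lower s = c -> c = tile i.
    by move=> /is_tileP[j <-] /sidesE/i_uniq ->.
  have ts : is_tile s.1 || is_tile (lower s).
    by case: is_i => ->; rewrite is_tile_tile ?orbT.
  case: (boolP (is_tile s.1)) ts => t1;
    case: (boolP (is_tile (lower s))) => t2 //= _.
  have := lower_neq s.
  by rewrite (iuniq _ t1 (or_introl erefl)) (iuniq _ t2 (or_intror erefl)) eqxx.
have uniq_c c c' : is_tile c -> ~~ is_tile c' ->
    (forall j, sides (tile j) s <-> c = tile j \/ c' = tile j) -> boundary_edge w s.
  move=> /is_tileP[i <-] tc' sE; exists i; split; first by apply/sE; left.
  move=> j /sE[/tile_inj //|c'E]; by rewrite c'E is_tile_tile in tc'.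
case: (boolP (is_tile s.1)) => t1; case: (boolP (is_tile (lower s))) => t2 // _.
  by apply: (uniq_c _ _ t1 t2) => j; exact: sidesE.
by apply: (uniq_c _ _ t2 t1) => j; rewrite sidesE or_comm.
Qed.

Lemma is_sinkE i : is_sink i <-> closed dir [set i].
Proof.
split=> [[sl sr] j k + /finset.set1P ji|cS].
  rewrite ji /step => /orP[]/andP[/eqP ki].
    have iw : (i < size w)%N by rewrite -ltnS -ki.
    move: iw; rewrite /letter_dir -onthTE; case E: (onth w i) => [l|//] _.
    by rewrite (negbTE (sr l E)).
  rewrite /letter_dir; case E: (onth w k) => [l|//] /negP[].
  exact: (sl k l).
split=> [k l ki kl|l il].
  have kn : (k < n)%N by rewrite -ltnS ki ltnW // ltnS.
  apply: contraT => dl; have /cS := finset.set11 i => H.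
  have := H (Ordinal kn); rewrite /step /= -ki eqxx /letter_dir kl dl orbT.
  by move=> /(_ isT)/finset.set1P/(congr1 val) /=; rewrite -ki => /n_Sn.
have iw : (i < size w)%N by rewrite -onthTE il.
apply/negP => dl; have := cS i (Ordinal (iw : i.+1 < n)%N).
rewrite /step /= eqxx /letter_dir il dl => /(_ isT (finset.set11 i)).
by move=> /finset.set1P/(congr1 val)/esym/n_Sn.
Qed.

(** By [closed_tileP], a neighbour across a side with orientation [parity (tile i)] would receive an
    arrow from [i]. *)
Lemma sink_neighbours i : is_sink i ->
  ~~ is_tile (lower (tile i, parity (tile i))) &&
  ~~ is_tile (beyond (parity (tile i)) (tile i)).
Proof.
move=> /is_sinkE/closed_tileP cS; set h := parity (tile i).
have one c : tile_in [set i] c -> c = tile i.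
  by move=> /tile_inP[j /finset.set1P -> <-].
have ne c : c != tile i -> tile_in [set i] c = false.
  by move=> ci; apply: contraNF ci => /one ->.
have ti : tile_in [set i] (tile i) by rewrite tile_in_tile finset.set11.
have [cl cb] := cS (tile i); have [cr ca] := cS (beyond h (tile i)).
have nl : lower (tile i, h) != tile i by exact: lower_neq (tile i, h).
have nb : beyond h (tile i) != tile i.
  by have := lower_neq (beyond h (tile i), h); rewrite lower_beyond eq_sym.
apply/andP; split; apply/negP => t.
  move: cl cb t nl; rewrite is_tile_tile /lower -/h /=.
  case: h {nb cr ca} => /= cl cb t nl.
    by have := cb isT t ti; rewrite ne.
  by have := cl isT t ti; rewrite ne.
move: cr ca; rewrite t parity_beyond -/h; move: nb t.
rewrite /beyond; case: h {nl} => /= nb t; rewrite ?aboveK ?right_ofK is_tile_tile.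
  by move=> _ /(_ isT isT ti); rewrite ne.
by move=> /(_ isT isT ti); rewrite ne.
Qed.

(** Growing the empty closed set by one position gives a closed singleton. *)
Lemma is_sink_ex : exists i : 'I_n, is_sink i.
Proof.
have [|i _] := closed_grow (@closed0 dir n) (@closedT dir n).
  by apply/properP; split; [exact: finset.sub0set|exists ord0; rewrite ?inE].
by rewrite finset.setU0 => /is_sinkE; exists i.
Qed.

Definition matching_of eps S : set segment :=
  [set s | snake_matching eps S s]%classic.

Lemma matching_of_minimal : is_minimal_matching w (matching_of false finset.set0).
Proof.
split.
- by apply: snake_matching_perfect => //; exact: closed0.
- move=> s; rewrite /matching_of /= => Ps; apply/boundary_edgeE; move: Ps.
  by rewrite /snake_matching !tile_in0 !addbF => /andP[].
- move=> i /sink_neighbours; set c := tile i; set h := parity c => /andP[tl tb].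
  have tc : is_tile c by exact: is_tile_tile.
  (* These are the parallel sides that the matching takes on this tile: horizontal for odd numbers,
     vertical for even ones. *)
  exists (c, h), (beyond h c, h).
  split.
  + by case=> cb; move: tb; rewrite -cb tc.
  + by split; apply/sides_beyond; [left|right].
  + split; apply/boundary_edgeE; rewrite ?lower_beyond /= tc ?(negbTE tl) //.
    by rewrite (negbTE tb).
  + rewrite /matching_of /snake_matching /= !tile_in0 lower_beyond parity_beyond.
    by rewrite tc (negbTE tl) (negbTE tb) -/h; case: (h).
Qed.

Lemma matching_ofE (P : set segment) : P = [set s | `[<P s>]]%classic.
Proof. by apply/seteqP; split=> s /asboolP. Qed.

Lemma minimal_matching_uniq (P : set segment) : is_minimal_matching w P ->
  exists2 eps : bool, (eps -> size w = 0%N) & P = matching_of eps finset.set0.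
Proof.
move=> [Pperf Pbd Psink]; rewrite (matching_ofE P) in Pperf.
have [//|S cS PS] := perfect_matching_snake (eps := false) _ Pperf.
(* With a single tile [S] is empty or everything, and exchanging the sides of this tile is what
   [eps] does. *)
have [w0|w_gt0] := posnP (size w).
  exists (ord0 \in S) => //; rewrite (matching_ofE P).
  have tS c : tile_in S c = is_tile c && (ord0 \in S).
    case: (boolP (is_tile c)) => [/is_tileP[i <-]|]; last first.
      by apply: contraNF; exact: tile_in_is_tile.
    rewrite tile_in_tile; congr (_ \in S); apply: val_inj.
    by move: (ltn_ord i) => /=; lia.
  rewrite /matching_of; congr mkset; apply/funext => s; rewrite PS.
  have one : ~~ (is_tile s.1 && is_tile (lower s)).
    apply/negP => /andP[t1 t2].
    by have := no_eps (eps := true) (fun=> w0) t2 t1 (lower_neq s).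
  suff -> : snake_matching false S s =
    snake_matching (ord0 \in S) finset.set0 s by [].
  rewrite /snake_matching !tile_in0 !tS; move: one.
  case: (is_tile s.1); case: (is_tile (lower s)); case: (ord0 \in S) => //= _;
    by case: s.2; case: (parity _).
exists false => //; rewrite (matching_ofE P); apply/seteqP.
suff S0 : S = finset.set0 by split=> s; rewrite /matching_of /= PS S0.
(* No shared segment is in [P], so neighbouring tiles are both in [S] or both outside, and [S] is
   empty or everything. *)
have shared s : is_tile s.1 -> is_tile (lower s) ->
    tile_in S s.1 = tile_in S (lower s).
  move=> t1 t2; have Ps : ~ P s by move=> /Pbd/boundary_edgeE; rewrite t1 t2.
  have := PS s; rewrite asboolF // /snake_matching t1 t2 /=.
  by move/esym/negbT; rewrite negb_add => /eqP.
have link i j : j = i.+1 :> nat -> (j \in S) = (i \in S).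
  move=> /(@tile_step Q w) ji; rewrite -!tile_in_tile.
  have [h hE] : exists h, tile i = lower (tile j, h).
    by case: ifP ji => _ <-; [exists false|exists true].
  rewrite hE; apply: (shared (tile j, h)); rewrite -?hE; exact: is_tile_tile.
have all_S i : (i \in S) = (ord0 \in S).
  case: i => k; elim: k => [|k IH] kn; first by congr (_ \in S); exact: val_inj.
  by rewrite -(IH (ltnW kn)); exact: link.
case S0: (ord0 \in S); last by apply/setP => i; rewrite all_S S0 inE.
have ST c : tile_in S c = is_tile c.
  apply/idP/idP; first exact: tile_in_is_tile.
  by move=> /is_tileP[i <-]; rewrite tile_in_tile all_S.
(* If [S] were everything, the two boundary edges in [P] at a sink would be the pair of sides
   opposite in orientation to that of [sink_neighbours]. All four sides would then be boundary
   edges, so this tile would be alone. *)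
have [i sink_i] := is_sink_ex.
have [s [t [st [si ti] [bs bt] [Ps Pt]]]] := Psink i sink_i.
have nb h : h = ~~ parity (tile i) ->
    ~~ is_tile (lower (tile i, h)) && ~~ is_tile (beyond h (tile i)).
  have dir_of u : sides (tile i) u -> boundary_edge w u -> P u ->
      u.2 = ~~ parity (tile i).
    move=> /sidesE ui /boundary_edgeE bu Pu; have := PS u.
    rewrite asboolT // /snake_matching !ST bu /= => /esym.
    case: ui bu => ui.
      by rewrite ui is_tile_tile; case: u.2; case: (parity _).
    rewrite ui is_tile_tile addbT => /negbTE -> /=.
    by rewrite -ui parity_lower; case: u.2; case: (parity _).
  move=> hE; have := dir_of s si bs Ps; have := dir_of t ti bt Pt.
  rewrite -hE => tE sE; move: si ti bs bt st => /sides_beyond + /sides_beyond.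
  rewrite sE tE => -[] -> [] -> /boundary_edgeE + /boundary_edgeE //=.
    by rewrite lower_beyond is_tile_tile addbT /= => -> ->.
  by rewrite lower_beyond is_tile_tile addbT /= => -> ->.
have alone h : ~~ is_tile (lower (tile i, h)) && ~~ is_tile (beyond h (tile i)).
  have := sink_neighbours sink_i; have := nb _ erefl.
  by case: h; case: (parity _).
have [ilt|] := ltnP i (size w).
  have := @tile_step Q w i (Ordinal (ilt : i.+1 < n)%N) erefl.
  set j := Ordinal _; have ntj h : tile j <> beyond h (tile i).
    by move=> jE; move: (alone h); rewrite -jE is_tile_tile andbF.
  case: ifP => _ ij; [case: (ntj false)|case: (ntj true)];
    by rewrite /beyond -ij ?left_ofK ?belowK.
move=> ige; have jn : (i.-1 < n)%N by rewrite (leq_ltn_trans (leq_pred _)).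
have ij : i = (Ordinal jn).+1 :> nat by rewrite /= prednK // (leq_trans w_gt0).
have := tile_step ij; have ntj h : tile (Ordinal jn) <> lower (tile i, h).
  by move=> jE; move: (alone h); rewrite -jE is_tile_tile.
by case: ifP => _ ji; [case: (ntj false)|case: (ntj true)]; rewrite -ji.
Qed.

Lemma minimal_matchingE : exists2 eps : bool, (eps -> size w = 0%N) &
  minimal_matching w = matching_of eps finset.set0.
Proof.
apply: minimal_matching_uniq; apply: xgetPex; exists (matching_of false finset.set0).
exact: matching_of_minimal.
Qed.

Section Enclosed.
Variables (S : {set 'I_n}) (D : set segment).
Hypothesis DE : forall s, D s <-> tile_in S s.1 (+) tile_in S (lower s).

Lemma connected_tile_in c c' :
  clos_refl_trans square (adjacent_off D) c c' -> tile_in S c = tile_in S c'.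
Proof.
elim=> // [{}c {}c' [s [/sidesE sc /sidesE sc' /DE sD]]|? ? ? _ -> _ ->] //.
by move: sD; case: sc => <-; case: sc' => <- //;
  case: (tile_in S _); case: (tile_in S _) => // -[].
Qed.

Lemma connected_ray h c (k : nat) :
  (forall l : nat, ~~ tile_in S (iter l (fun c => lower (c, h)) c)) ->
  clos_refl_trans square (adjacent_off D) c (iter k (fun c => lower (c, h)) c).
Proof.
move=> out; elim: k => [|k IH]; first exact: rt_refl.
apply: rt_trans IH (rt_step _ _ _ _ _); rewrite iterS.
move: (out k) (out k.+1); rewrite iterS; move: (iter k _ c) => c' cS lS.
exists (c', h); split; [by apply/sidesE; left|by apply/sidesE; right|].
by move/DE; rewrite /= (negbTE cS) (negbTE lS).
Qed.

Lemma iter_lower h c (k : nat) : iter k (fun c => lower (c, h)) c =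
  if h then (c.1, c.2 - k%:Z) else (c.1 - k%:Z, c.2).
Proof.
elim: k => [|k IH]; first by case: h c => -[a b]; rewrite /= subr0.
rewrite iterS IH; case: h {IH}; rewrite /lower /below /left_of /=; congr pair; lia.
Qed.

(* The tiles preceding a tile cannot lie both in its row and in its column. *)
Lemma free_ray i : exists h, forall k : nat,
  ~~ is_tile (iter k.+1 (fun c => lower (c, h)) (tile i)).
Proof.
apply: contrapT => /forallNP none.
have [k1 /is_tileP[j1]] : exists k : nat,
    is_tile (iter k.+1 (fun c => lower (c, true)) (tile i)).
  apply: contrapT => /forallNP nk; apply: (none true) => k; exact/negP/nk.
have [k2 /is_tileP[j2]] : exists k : nat,
    is_tile (iter k.+1 (fun c => lower (c, false)) (tile i)).
  apply: contrapT => /forallNP nk; apply: (none false) => k; exact/negP/nk.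
rewrite !iter_lower !tileE /= => -[x2 y2] [x1 y1].
have Ei := tile_xy (leq_ord i); have E1 := tile_xy (leq_ord j1).
have E2 := tile_xy (leq_ord j2).
have [le12|/ltnW le21] := leqP j1 j2.
  by have := tile_x_le le12 (leq_ord j2); lia.
by have := tile_y_le le21 (leq_ord j1); lia.
Qed.

(** From a tile outside [S] the ray of [free_ray] meets no tile of [S] and escapes uncut; the
    component of a tile in [S] stays among the finitely many tiles of [S]. *)
Lemma enclosedE i : enclosed D (tile i) <-> i \in S.
Proof.
split=> [[N bound]|iS].
  rewrite -tile_in_tile; apply: contrapT => /negP iS.
  have [h out] := free_ray i.
  (* Whichever coordinate the ray decreases, [k] steps bring it below the negative of the absolute
     value of [N]. *)
  pose k := (`|N| + tile_x w i + tile_y w i).+1%N.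
  have ray : forall l : nat, ~~ tile_in S (iter l (fun c => lower (c, h)) (tile i)).
    case=> [//|l]; apply: contra (out l); exact: tile_in_is_tile.
  by have := bound _ (connected_ray k ray); 
    rewrite iter_lower tileE /k; case: (h) => /=; lia.
exists n%:Z => c /connected_tile_in; rewrite tile_in_tile iS.
move=> /esym/tile_inP[j _ <-]; rewrite tileE /=.
by have := tile_xy (leq_ord j); have := leq_ord j; lia.
Qed.
End Enclosed.

(** At a corner of the tile two of its sides are flipped and the degree stays 1, so [P] contains
    exactly one of them. Three corners then show that [P] contains a pair of opposite sides and
    avoids the other pair. *)
Lemma rotation_sides i P P' :
  perfect_matchings w [set s | P s]%classic ->
  perfect_matchings w [set s | P' s]%classic ->
  (forall s, P' s = P s (+) `[<sides (tile i) s>]) ->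
  rotation i [set s | P s]%classic [set s | P' s]%classic.
Proof.
move=> /perfect_matchingsE[_ Pdeg] /perfect_matchingsE[_ P'deg] P'E.
set c := tile i; have tc : is_tile c by exact: is_tile_tile.
have flip s : sides c s -> P' s = ~~ P s.
  by move=> sc; rewrite P'E asboolT // addbT.
have keep s : ~ sides c s -> P' s = P s.
  by move=> sc; rewrite P'E asboolF // addbF.
have scE h : sides c (c, h) by apply/sides_beyond; left.
have sbE h : sides c (beyond h c, h) by apply/sides_beyond; right.
have T1 : P (c, true) = ~~ P (c, false).
  have := Pdeg c; have := P'deg c; rewrite /touches tc => /(_ isT) + /(_ isT).
  rewrite /degree (flip (c, true)) // (flip (c, false)) //.
  by case: (P (c, true)); case: (P (c, false)) => //=; lia.
have T2 : P (c, true) = ~~ P (right_of c, false).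
  have := Pdeg (right_of c); have := P'deg (right_of c).
  rewrite /touches right_ofK tc !orbT => /(_ isT) + /(_ isT).
  rewrite /degree right_ofK (flip (c, true)) // (flip (right_of c, false));
    last exact: (sbE false).
  by case: (P (c, true)); case: (P (right_of c, false)) => //=; lia.
have T3 : P (above c, true) = ~~ P (c, false).
  have := Pdeg (above c); have := P'deg (above c).
  rewrite /touches aboveK tc !orbT => /(_ isT) + /(_ isT).
  rewrite /degree aboveK (flip (c, false)) // (flip (above c, true));
    last exact: (sbE true).
  by case: (P (c, false)); case: (P (above c, true)) => //=; lia.
have main h : P (c, h) -> P (beyond h c, h) -> ~~ P (c, ~~ h) ->
    ~~ P (beyond (~~ h) c, ~~ h) -> forall s, P' s <->
    P s /\ ~ (s = (c, h) \/ s = (beyond h c, h)) \/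
    (s = (c, ~~ h) \/ s = (beyond (~~ h) c, ~~ h)).
  move=> P1 P2 P3 P4 s; have [sc|sc] := pselect (sides c s).
    have hh : h <> ~~ h by case: (h).
    rewrite flip //; move/sides_beyond: sc; case: s => v k /=.
    have [->|kh] := eqVneq k h => -[] [->].
    - rewrite P1; split=> // -[[_ []]|[]/(congr1 snd)/hh //]; by left.
    - rewrite P2; split=> // -[[_ []]|[]/(congr1 snd)/hh //]; by right.
    - have -> : k = ~~ h by move: kh; case: (k); case: (h).
      by rewrite P3; split=> // _; right; left.
    - have -> : k = ~~ h by move: kh; case: (k); case: (h).
      by rewrite P4; split=> // _; right; right.
  rewrite keep //; split=> [Ps|[[//]|]].
    by left; split=> // -[] sE; apply: sc; rewrite sE.
  by case=> sE; case: sc; rewrite sE.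
have hor : horizontal_sides c =
  [set s | s = (c, true) \/ s = (beyond true c, true)]%classic by [].
have ver : vertical_sides c =
  [set s | s = (c, false) \/ s = (beyond false c, false)]%classic by [].
have Q1 : P (c, false) = ~~ P (c, true) by rewrite T1 negbK.
have Q2 : P (beyond false c, false) = ~~ P (c, true) by rewrite T2 negbK.
have Q3 : P (beyond true c, true) = P (c, true) by rewrite /= T3 Q1 negbK.
rewrite /rotation -/c hor ver; case: (boolP (P (c, true))) Q1 Q2 Q3 => Pc Q1 Q2 Q3;
  [left|right]; split.
- by move=> s [] -> /=; rewrite ?Q3.
- by apply/seteqP; split=> s /(main true); apply; rewrite /= ?Q1 ?Q2 ?Q3.
- by move=> s [] -> /=; rewrite ?Q1 ?Q2.
- by apply/seteqP; split=> s /(main false); apply; rewrite /= ?Q1 ?Q2 ?Q3.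
Qed.
End MatchingLattice.

(** * The isomorphism from closed sets to perfect matchings *)

Section MatchingIso.
Variables (Q : quiver) (w : seq (letter Q)).
Local Notation n := (size w).+1.
Local Notation dir := (letter_dir w).
Local Notation matching_of := (@matching_of Q w).
Implicit Types (i j : 'I_n) (S : {set 'I_n}).
Variable eps : bool.
Hypothesis eps0 : eps -> size w = 0%N.
Hypothesis min_eps : minimal_matching w = matching_of eps finset.set0.

Lemma enclosed_tilesE S i : @enclosed_tiles Q w (matching_of eps S) i <-> i \in S.
Proof.
rewrite /enclosed_tiles /= min_eps; apply: enclosedE => s.
rewrite /setY /matching_of /= snake_matchingS.
by case: (snake_matching eps _ s); case: (tile_in S _); case: (tile_in S _);
  split=> //=; intuition.
Qed.

Lemma matching_covers_U1 S i : closed dir S -> closed dir (i |: S) ->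
  i \notin S -> matching_covers w (matching_of eps S) (matching_of eps (i |: S)).
Proof.
move=> cS ciS iS; split; try exact: snake_matching_perfect.
exists i; last first.
  apply/seteqP; split=> j; rewrite enclosed_tilesE.
    by rewrite !inE => /orP[/eqP|]; [right|left; apply/enclosed_tilesE].
  by case=> [/enclosed_tilesE|/= ->]; rewrite !inE ?eqxx // => ->; rewrite orbT.
apply: rotation_sides; try exact: snake_matching_perfect.
move=> s; rewrite snake_matchingS [in RHS]snake_matchingS -addbA; congr addb.
rewrite !tile_inU1 // addbACA addbC; congr addb.
have ne := lower_neq s; apply/idP/asboolP => [|/sidesE[E|E]].
- by case: eqP => [is1 _|_ /eqP is1]; apply/sidesE; [left|right].
- by rewrite E eqxx; rewrite -E eq_sym (negbTE ne).
- by rewrite E eqxx; rewrite -E (negbTE ne).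
Qed.

Lemma matching_le_subset S S' : closed dir S -> closed dir S' ->
  S \subset S' -> matching_le w (matching_of eps S) (matching_of eps S').
Proof.
move=> + cS'; move: {2}#|S' :\: S| (leqnn #|S' :\: S|) => k.
elim: k S => [|k IH] S Sk cS SS'.
  suff -> : S = S' by exact: rt_refl.
  apply/eqP; rewrite finset.eqEsubset SS' /=.
  by move: Sk; rewrite leqn0 cards_eq0 finset.setD_eq0.
have [<-|SS'n] := eqVneq S S'; first exact: rt_refl.
have [|j jS cj] := closed_grow cS cS'; first by rewrite finset.properEneq SS'n.
have /finset.setDP[jS' jS0] := jS.
apply: (rt_trans _ _ _ (matching_of eps (j |: S))).
  by apply: rt_step; exact: matching_covers_U1.
apply: IH => //; last by rewrite finset.subUset finset.sub1set jS'.
rewrite -ltnS; apply: leq_trans Sk; apply: proper_card; apply/properP; split.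
  by apply/finset.setDS/finset.subsetUr.
by exists j; rewrite // inE finset.setU11.
Qed.

(** Enclosed tiles are only gained along a cover, and they recover [S] from its matching. *)
Lemma subset_matching_le S S' :
  matching_le w (matching_of eps S) (matching_of eps S') -> S \subset S'.
Proof.
have le P P' : matching_le w P P' ->
    (@enclosed_tiles Q w P `<=` @enclosed_tiles Q w P')%classic.
  elim=> [? ? [_ _ [i _ ->]] j|?|? ? ? _ + _ + j]; [by left|by []|].
  by move=> h1 h2 /h1/h2.
move=> /le SS'; apply/fintype.subsetP => i iS.
by apply/enclosed_tilesE/SS'/enclosed_tilesE.
Qed.

Lemma matching_iso : order_iso (@closed dir n) (fun S S' => S \subset S')
  (perfect_matchings w) (@matching_le Q w) (matching_of eps).
Proof.
split=> [|S S' cS cS']; last first.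
  by split; [exact: matching_le_subset|exact: subset_matching_le].
split=> [S cS|S S' _ _ SS'|P].
- exact: snake_matching_perfect.
- apply/setP => i; apply/idP/idP => /enclosed_tilesE; rewrite ?SS' => H;
    by apply/enclosed_tilesE; rewrite ?SS'.
- rewrite {1}(matching_ofE P) => /(perfect_matching_snake eps0)[S cS PS].
  exists S => //; rewrite [RHS]matching_ofE; congr mkset.
  by apply/funext => s; rewrite PS.
Qed.
End MatchingIso.

Theorem theorem3p18 (K : fieldType) (Q : quiver) (I : admissible_ideal K Q)
    (x : vertex Q) (w : seq (letter Q)) (w_string : is_string I x w)
    (M : lmodType (GRing.converse (bound_algebra I))) (e : 'I_(size w).+1 -> M)
    (M_w : is_string_module x e) :
  let sigma := associated_coxeter e in
  [/\ is_lattice (weak_interval 1%g sigma) (@weak_le (size w).+1),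
      is_lattice (canonical_submodules e) (@submodule_le K Q I M),
      is_lattice (perfect_matchings w) (@matching_le Q w),
      exists f : 'S_(size w).+2 -> set M,
        lattice_iso (weak_interval 1%g sigma) (@weak_le (size w).+1)
                    (canonical_submodules e) (@submodule_le K Q I M) f &
      exists g : set M -> set segment,
        lattice_iso (canonical_submodules e) (@submodule_le K Q I M)
                    (perfect_matchings w) (@matching_le Q w) g].
Proof.
move=> sigma; have [s [es full sE]] := associated_coxeter_word M_w.
have weakI := weak_interval_iso es full; rewrite -sE -/sigma in weakI.
have subI := canonical_submodules_iso M_w.
have [eps eps0 min_eps] := minimal_matchingE w.
have matchI := matching_iso eps0 min_eps.
have latt := closed_lattice (letter_dir w) (size w).+1.
split.
- exact: (order_iso_lattice weakI latt).
- exact: (order_iso_lattice subI latt).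
- exact: (order_iso_lattice matchI latt).
- have [f fI] := order_iso_span finset.set0 weakI subI.
  by exists f; exact: order_iso_lattice_iso fI.
- have [g gI] := order_iso_span finset.set0 subI matchI.
  by exists g; exact: order_iso_lattice_iso gI.
Qed.
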